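(* (a) Let $R$ be an order domain over $\mathbb{F}_q$ with a given finitely generated value semigroup $\Gamma\subset\mathbb{Z}_{\ge 0}^r$, and let $R_\Gamma=\mathbb{F}_q[\Gamma]\cong\mathbb{F}_q[X_1,\ldots,X_s]/I_\Gamma$. Then $R$ has a flat deformation to $R_\Gamma$. (b) Conversely, let $\Gamma=\langle M\rangle\subset\mathbb{Z}_{\ge 0}^r$ be the semigroup generated by the columns of an $r\times s$ matrix $M$ with entries in $\mathbb{Z}_{\ge 0}$ and linearly independent rows. Let $I\subset\mathbb{F}_q[X_1,\ldots,X_s]$ be an ideal (so that $\mathbb{F}_q[X_1,\ldots,X_s]/I$ is a flat deformation of $R_\Gamma$) whose reduced Gröbner basis $G$ with respect to a weight order $>_{M,\tau}$ has the property that every element of $G$ has exactly two monomials of highest $M$-weight in its support, and such that the monomials in the complement of the leading term ideal $LT_{>_{M,\tau}}(I)$ have distinct $M$-weights. Then $\mathbb{F}_q[X_1,\ldots,X_s]/I$ is an order domain with value semigroup $\Gamma$.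
   Context: $\mathbb{F}_q$ is a finite field. Order domain: Let $R$ be a commutative $\mathbb{F}_q$-algebra and let $(\Gamma,+,\succ)$ be a well-ordered commutative semigroup (the order is compatible with addition: $\alpha \prec \beta$ implies $\alpha+\gamma \prec \beta+\gamma$). An order function on $R$ is a surjective mapping $\rho : R \to \{-\infty\}\cup\Gamma$ satisfying: (i) $\rho(f) = -\infty \Leftrightarrow f=0$; (ii) $\rho(cf)=\rho(f)$ for all $f \in R$ and all $c\neq 0$ in $\mathbb{F}_q$; (iii) $\rho(f+g) \preceq \max_\succ\{\rho(f),\rho(g)\}$ for all $f,g\in R$; (iv) if $\rho(f)=\rho(g)\ne -\infty$, then there exists $c\neq 0$ in $\mathbb{F}_q$ such that $\rho(f-cg) \prec \rho(f)$; (v) $\rho(fg)=\rho(f)+\rho(g)$. $\Gamma$ is the value semigroup of $\rho$, and an order domain is a pair $(R,\rho)$. Semigroups $\Gamma\subset\mathbb{Z}_{\ge 0}^r$ are ordered by (the restriction of) a monomial order $\succ$ on $\mathbb{Z}_{\ge 0}^r$. Toric algebra: For $\Gamma\subset\mathbb{Z}_{\ge 0}^r$, $R_\Gamma=\mathbb{F}_q[\Gamma]$ is the subring of $\mathbb{F}_q[T_1,\ldots,T_r]$ generated by the monomials $T^\gamma$, $\gamma\in\Gamma$. If $M$ is the $r\times s$ matrix whose columns $\gamma_1,\ldots,\gamma_s$ form a generating set of $\Gamma$, then $I_\Gamma\subset\mathbb{F}_q[X_1,\ldots,X_s]$ is the ideal generated by all binomials $X^\alpha-X^\beta$ with $M\alpha=M\beta$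 (the toric ideal). Weight orders: The $M$-weight of $X^\alpha$ is $M\alpha\in\mathbb{Z}_{\ge 0}^r$. For a monomial order $\tau$, define $X^\alpha>_{M,\tau}X^\beta$ if $M\alpha\succ M\beta$, or $M\alpha=M\beta$ and $X^\alpha>_\tau X^\beta$. Flat deformation: $R$ has a flat deformation to $R_\Gamma$ if there is a flat one-parameter family over the affine line $\mathbb{A}^1_t$ with general fibre $R$ and special fibre $R_\Gamma$, i.e. a flat $\mathbb{F}_q[t]$-algebra $\mathcal{R}$ with $\mathcal{R}/t\mathcal{R}\cong R_\Gamma$ and $\mathcal{R}[t^{-1}]\cong R\otimes_{\mathbb{F}_q}\mathbb{F}_q[t,t^{-1}]$ over $\mathbb{F}_q[t,t^{-1}]$. *)

(* Defs.v *)
From HB Require Import structures.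
From mathcomp Require Import all_boot all_algebra.
From mathcomp Require Import ring boolp mpoly.

Set Implicit Arguments.
Unset Strict Implicit.
Unset Printing Implicit Defensive.

Import GRing.Theory.
Local Open Scope ring_scope.
Local Open Scope quotient_scope.

Section TensorProduct.
Variables (K : comNzRingType) (N M : lmodType K).

(* A formal sum of pure tensors is a sequence of pairs; two formal sums are   *)
(* equal in N (x) M iff no bilinear map separates them.                       *)
Definition teq (s s' : seq (N * M)) : bool :=
  `[< forall (P : lmodType K) (b : N -> M -> P), bilinear_for *:%R *:%R b ->
        \sum_(x <- s) b x.1 x.2 = \sum_(x <- s') b x.1 x.2 >].

Lemma teq_is_equiv : equiv_class_of teq.
Proof.
split=> [s|s s'|s2 s1 s3].
- by apply/asboolP.
- by apply/asboolP/asboolP => h P b hb; rewrite (h P b hb).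
- by move=> /asboolP h /asboolP h'; apply/asboolP => P b hb; rewrite h // h'.
Qed.

Canonical teq_equiv := EquivRelPack teq_is_equiv.
Canonical teq_encModRel := defaultEncModRel teq.

Definition tensor := {eq_quot teq}.
HB.instance Definition _ : EqQuotient (seq (N * M)) teq tensor :=
  EqQuotient.on tensor.
HB.instance Definition _ := Choice.on tensor.

Variant tensor_spec : tensor -> Type :=
  TensorSpec s : tensor_spec (\pi_tensor s).

Lemma tensorP u : tensor_spec u.
Proof. by rewrite -[u]reprK. Qed.

Lemma tensor_eqP s s' : teq s s' -> \pi_tensor s = \pi_tensor s'.
Proof. by move=> h; apply/eqmodP. Qed.

Lemma teq_repr s : teq (repr (\pi_tensor s)) s.
Proof. by apply/eqmodP; rewrite reprK. Qed.

Definition pure (n : N) (m : M) : tensor := \pi_tensor [:: (n, m)].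

Definition tensor_zero : tensor := \pi_tensor [::].
Definition tensor_opp (u : tensor) : tensor :=
  \pi_tensor [seq (- x.1, x.2) | x <- repr u].
Definition tensor_add (u v : tensor) : tensor := \pi_tensor (repr u ++ repr v).

Lemma bilinear_for_oppl (P : lmodType K) (b : N -> M -> P) n m :
  bilinear_for *:%R *:%R b -> b (- n) m = - b n m.
Proof.
case=> bl _; have bB := zmod_morphism_linear (bl m).
have b0 : b 0 m = 0 by have := bB 0 0; rewrite !subrr.
by have := bB 0 n; rewrite b0 !sub0r.
Qed.

Lemma tensor_oppE s :
  tensor_opp (\pi_tensor s) = \pi_tensor [seq (- x.1, x.2) | x <- s].
Proof.
apply: tensor_eqP; apply/asboolP => P b hb; rewrite !big_map /=.
have /asboolP/(_ P b hb) h := teq_repr s.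
under eq_bigr do rewrite bilinear_for_oppl //.
under [RHS]eq_bigr do rewrite bilinear_for_oppl //.
by rewrite !sumrN h.
Qed.

Lemma tensor_addE s s' :
  tensor_add (\pi_tensor s) (\pi_tensor s') = \pi_tensor (s ++ s').
Proof.
apply: tensor_eqP; apply/asboolP => P b hb; rewrite !big_cat /=.
have /asboolP/(_ P b hb) -> := teq_repr s.
by have /asboolP/(_ P b hb) -> := teq_repr s'.
Qed.

Lemma tensor_addA : associative tensor_add.
Proof.
move=> x y z; case/tensorP: x => x; case/tensorP: y => y.
by case/tensorP: z => z; rewrite !tensor_addE catA.
Qed.

Lemma tensor_addC : commutative tensor_add.
Proof.
move=> x y; case/tensorP: x => x; case/tensorP: y => y; rewrite !tensor_addE.
by apply: tensor_eqP; apply/asboolP => P b hb; rewrite !big_cat /= addrC.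
Qed.

Lemma tensor_add0 : left_id tensor_zero tensor_add.
Proof. by move=> x; case/tensorP: x => x; rewrite tensor_addE. Qed.

Lemma tensor_addN : left_inverse tensor_zero tensor_opp tensor_add.
Proof.
move=> x; case/tensorP: x => x; rewrite tensor_oppE tensor_addE.
apply: tensor_eqP.
apply/asboolP => P b hb; rewrite big_cat big_map big_nil /=.
by under eq_bigr do rewrite bilinear_for_oppl //; rewrite sumrN addNr.
Qed.

HB.instance Definition _ := GRing.isZmodule.Build tensor
  tensor_addA tensor_addC tensor_add0 tensor_addN.

End TensorProduct.

(* f (x) id_M *)
Definition tensor_mapl (K : comNzRingType) (N N' M : lmodType K) (f : N -> N')
    (u : tensor N M) : tensor N' M :=
  \pi_(tensor N' M) [seq (f x.1, x.2) | x <- repr u].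

Definition flat (K : comNzRingType) (M : lmodType K) : Prop :=
  forall (N N' : lmodType K) (f : {linear N -> N'}),
    injective f -> injective (@tensor_mapl K N N' M f).

Section TensorAlgebra.
Variables (K : comNzRingType) (A B : comAlgType K).
Implicit Types (s t : seq (A * B)).

Definition tprod s t : seq (A * B) :=
  [seq (x.1 * y.1, x.2 * y.2) | x <- s, y <- t].

Definition tensor_one : tensor A B := pure 1 1.
Definition tensor_mul (u v : tensor A B) : tensor A B :=
  \pi_(tensor A B) (tprod (repr u) (repr v)).

Lemma sum_tprod (V : zmodType) (b : A -> B -> V) s t :
  \sum_(z <- tprod s t) b z.1 z.2 =
  \sum_(x <- s) \sum_(y <- t) b (x.1 * y.1) (x.2 * y.2).
Proof. by rewrite big_allpairs_dep. Qed.

Lemma bilinear_for_mul (P : lmodType K) (b : A -> B -> P) a c :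
  bilinear_for *:%R *:%R b ->
  bilinear_for *:%R *:%R (fun x y => b (x * a) (y * c)).
Proof.
move=> [bl br]; split=> w k x y /=.
- by rewrite mulrDl -scalerAl bl.
- by rewrite mulrDl -scalerAl br.
Qed.

Lemma tprodC s t : teq (tprod s t) (tprod t s).
Proof.
apply/asboolP => P b hb; rewrite !sum_tprod exchange_big /=.
by do 2!apply: eq_bigr => ? _; rewrite mulrC [X in b _ X]mulrC.
Qed.

Lemma tprod_teql s s' t : teq s s' -> teq (tprod s t) (tprod s' t).
Proof.
move=> /asboolP h; apply/asboolP => P b hb.
rewrite !sum_tprod exchange_big [RHS]exchange_big /=.
by apply: eq_bigr => y _; rewrite (h _ _ (bilinear_for_mul y.1 y.2 hb)).
Qed.

Lemma tensor_mulE s t : 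
  tensor_mul (\pi_(tensor A B) s) (\pi_(tensor A B) t) =
  \pi_(tensor A B) (tprod s t).
Proof.
rewrite /tensor_mul (tensor_eqP (tprod_teql _ (teq_repr s))).
rewrite (tensor_eqP (tprodC _ _)) (tensor_eqP (tprod_teql _ (teq_repr t))).
exact/tensor_eqP/tprodC.
Qed.

Lemma tensor_mulA : associative tensor_mul.
Proof.
move=> x y z; case/tensorP: x => x; case/tensorP: y => y.
case/tensorP: z => z; rewrite !tensor_mulE.
apply: tensor_eqP; apply/asboolP => P b hb; rewrite !sum_tprod.
rewrite (@sum_tprod _ (fun u v => \sum_(w <- z) b (u * w.1) (v * w.2))).
apply: eq_bigr => u _.
rewrite (@sum_tprod _ (fun v w => b (u.1 * v) (u.2 * w))).
by do 2!apply: eq_bigr => ? _; rewrite !mulrA.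
Qed.

Lemma tensor_mulC : commutative tensor_mul.
Proof.
move=> x y; case/tensorP: x => x; case/tensorP: y => y; rewrite !tensor_mulE.
exact/tensor_eqP/tprodC.
Qed.

Lemma tensor_mul1 : left_id tensor_one tensor_mul.
Proof.
move=> x; case/tensorP: x => x; rewrite /tensor_one /pure tensor_mulE.
apply: tensor_eqP.
apply/asboolP => P b hb; rewrite sum_tprod big_seq1.
by apply: eq_bigr => y _; rewrite !mul1r.
Qed.

Lemma tensor_mulDl : left_distributive tensor_mul +%R.
Proof.
move=> x y z; case/tensorP: x => x; case/tensorP: y => y.
case/tensorP: z => z.
rewrite [_ + _]tensor_addE !tensor_mulE [_ + _]tensor_addE; apply: tensor_eqP.
by apply/asboolP => P b hb; rewrite big_cat /= !sum_tprod big_cat.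
Qed.

HB.instance Definition _ := GRing.Zmodule_isComPzRing.Build (tensor A B)
  tensor_mulA tensor_mulC tensor_mul1 tensor_mulDl.

End TensorAlgebra.

Section Localization.
Variables (A : comNzRingType) (a : A).

(* The pair (x, n) stands for the fraction x / a ^+ n. *)
Definition frac_eq (x y : A * nat) : bool :=
  `[< exists k, a ^+ k * (a ^+ y.2 * x.1) = a ^+ k * (a ^+ x.2 * y.1) >].

Lemma frac_eq_is_equiv : equiv_class_of frac_eq.
Proof.
split=> [x|x y|y x z].
- by apply/asboolP; exists 0%N.
- by apply/asboolP/asboolP => -[k e]; exists k; rewrite e.
move=> /asboolP[k e] /asboolP[l e']; apply/asboolP.
exists (k + l + y.2)%N; rewrite !exprD.
transitivity (a ^+ l * a ^+ z.2 * (a ^+ k * (a ^+ y.2 * x.1))); first by ring.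
rewrite e.
transitivity (a ^+ k * a ^+ x.2 * (a ^+ l * (a ^+ z.2 * y.1))); first by ring.
by rewrite e'; ring.
Qed.

Canonical frac_eq_equiv := EquivRelPack frac_eq_is_equiv.
Canonical frac_eq_encModRel := defaultEncModRel frac_eq.

Definition localization := {eq_quot frac_eq}.
HB.instance Definition _ : EqQuotient (A * nat)%type frac_eq localization :=
  EqQuotient.on localization.
HB.instance Definition _ := Choice.on localization.

Local Notation Aa := localization.

Definition frac (x : A) (n : nat) : Aa := \pi_Aa (x, n).

Variant frac_spec : Aa -> Type := FracSpec (x : A) n : frac_spec (frac x n).

Lemma fracP u : frac_spec u.
Proof. by rewrite -[u]reprK; case: (repr u). Qed.

Lemma frac_eqP x m y n :
  frac x m = frac y n <->
  exists k, a ^+ k * (a ^+ n * x) = a ^+ k * (a ^+ m * y).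
Proof.
split=> [/eqmodP/asboolP //|h].
by apply/eqmodP/asboolP.
Qed.

Lemma repr_frac x n :
  exists k, a ^+ k * (a ^+ n * (repr (frac x n)).1) =
            a ^+ k * (a ^+ (repr (frac x n)).2 * x).
Proof. by apply/frac_eqP; rewrite /frac -surjective_pairing reprK. Qed.

Definition loc_zero : Aa := frac 0 0.
Definition loc_one : Aa := frac 1 0.
Definition loc_opp (u : Aa) : Aa := frac (- (repr u).1) (repr u).2.
Definition loc_add (u v : Aa) : Aa :=
  frac (a ^+ (repr v).2 * (repr u).1 + a ^+ (repr u).2 * (repr v).1)
       ((repr u).2 + (repr v).2).
Definition loc_mul (u v : Aa) : Aa :=
  frac ((repr u).1 * (repr v).1) ((repr u).2 + (repr v).2).

Lemma loc_oppE x n : loc_opp (frac x n) = frac (- x) n.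
Proof.
by have [k e] := repr_frac x n; apply/frac_eqP; exists k; rewrite !mulrN e.
Qed.

Lemma loc_addE x m y n :
  loc_add (frac x m) (frac y n) = frac (a ^+ n * x + a ^+ m * y) (m + n).
Proof.
have [k e] := repr_frac x m; have [l e'] := repr_frac y n.
rewrite /loc_add; move: (repr (frac x m)) (repr (frac y n)) e e'.
move=> [x' m'] [y' n'] /= e e'.
apply/frac_eqP; exists (k + l)%N; rewrite !exprD.
transitivity (a ^+ l * a ^+ n' * a ^+ n * (a ^+ k * (a ^+ m * x')) +
              a ^+ k * a ^+ m' * a ^+ m * (a ^+ l * (a ^+ n * y'))).
  by ring.
by rewrite e e'; ring.
Qed.

Lemma loc_mulE x m y n :
  loc_mul (frac x m) (frac y n) = frac (x * y) (m + n).
Proof.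
have [k e] := repr_frac x m; have [l e'] := repr_frac y n.
rewrite /loc_mul; move: (repr (frac x m)) (repr (frac y n)) e e'.
move=> [x' m'] [y' n'] /= e e'.
apply/frac_eqP; exists (k + l)%N; rewrite !exprD.
transitivity ((a ^+ k * (a ^+ m * x')) * (a ^+ l * (a ^+ n * y'))).
  by ring.
by rewrite e e'; ring.
Qed.

Lemma loc_addA : associative loc_add.
Proof.
move=> u v w; case/fracP: u => x m; case/fracP: v => y n.
case/fracP: w => z p; rewrite !loc_addE; apply/frac_eqP; exists 0%N.
by rewrite !exprD; ring.
Qed.

Lemma loc_addC : commutative loc_add.
Proof.
move=> u v; case/fracP: u => x m; case/fracP: v => y n.
by rewrite !loc_addE addrC addnC.
Qed.

Lemma loc_add0 : left_id loc_zero loc_add.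
Proof.
by move=> u; case/fracP: u => x m; rewrite loc_addE mulr0 add0r mul1r.
Qed.

Lemma loc_addN : left_inverse loc_zero loc_opp loc_add.
Proof.
move=> u; case/fracP: u => x m; rewrite loc_oppE loc_addE mulrN addNr.
by apply/frac_eqP; exists 0%N; rewrite !mulr0.
Qed.

HB.instance Definition _ := GRing.isZmodule.Build Aa
  loc_addA loc_addC loc_add0 loc_addN.

Lemma loc_mulA : associative loc_mul.
Proof.
move=> u v w; case/fracP: u => x m; case/fracP: v => y n.
by case/fracP: w => z p; rewrite !loc_mulE mulrA addnA.
Qed.

Lemma loc_mulC : commutative loc_mul.
Proof.
move=> u v; case/fracP: u => x m; case/fracP: v => y n.
by rewrite !loc_mulE mulrC addnC.
Qed.

Lemma loc_mul1 : left_id loc_one loc_mul.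
Proof. by move=> u; case/fracP: u => x m; rewrite loc_mulE mul1r. Qed.

Lemma loc_mulDl : left_distributive loc_mul +%R.
Proof.
move=> u v w; case/fracP: u => x m; case/fracP: v => y n.
case/fracP: w => z p; rewrite [_ + _]loc_addE !loc_mulE [RHS]loc_addE.
by apply/frac_eqP; exists 0%N; rewrite !exprD; ring.
Qed.

HB.instance Definition _ := GRing.Zmodule_isComPzRing.Build Aa
  loc_mulA loc_mulC loc_mul1 loc_mulDl.

Lemma loc_inP x y : (frac x 0 + frac y 0 = frac (x + y) 0) *
                    (frac x 0 * frac y 0 = frac (x * y) 0).
Proof. by split; rewrite [LHS](loc_addE, loc_mulE) ?mul1r. Qed.

End Localization.

Section Laurent.
Variable F : fieldType.

Definition laurent := localization ('X : {poly F}).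
HB.instance Definition _ := GRing.ComPzRing.on laurent.

Lemma laurent_oner_neq0 : 1 != 0 :> laurent.
Proof.
apply/eqP => /frac_eqP[k] /eqP.
by rewrite !mul1r mulr0 mulr1 -[_ == 0]negbK expf_neq0 ?polyX_eq0.
Qed.

HB.instance Definition _ :=
  GRing.PzSemiRing_isNonZero.Build laurent laurent_oner_neq0.

Definition laurent_scale (c : F) (u : laurent) : laurent :=
  frac 'X c%:P 0 * u.

Lemma laurent_scaleA b c u :
  laurent_scale b (laurent_scale c u) = laurent_scale (b * c) u.
Proof. by rewrite /laurent_scale mulrA loc_inP polyCM. Qed.

Lemma laurent_scale1 : left_id 1 laurent_scale.
Proof. by move=> u; apply: mul1r. Qed.

Lemma laurent_scaleDr : right_distributive laurent_scale +%R.
Proof. by move=> c u v; apply: mulrDr. Qed.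

Lemma laurent_scaleDl u : {morph laurent_scale^~ u : b c / b + c}.
Proof. by move=> b c; rewrite /laurent_scale polyCD -loc_inP mulrDl. Qed.

HB.instance Definition _ := GRing.Zmodule_isLmodule.Build F laurent
  laurent_scaleA laurent_scale1 laurent_scaleDr laurent_scaleDl.

Lemma laurent_scaleAl c (u v : laurent) : c *: (u * v) = (c *: u) * v.
Proof. exact: mulrA. Qed.

HB.instance Definition _ :=
  GRing.LSemiModule_isLSemiAlgebra.Build F laurent laurent_scaleAl.
HB.instance Definition _ := GRing.Lalgebra_isComAlgebra.Build F laurent.

(* The structure map F[t, 1/t] -> S[1/t] of an F[t]-algebra S, sending        *)
(* p / t ^+ n to (p *: 1) / t ^+ n.                                           *)
Definition laurent_alg (S : comAlgType {poly F}) (u : laurent) :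
    localization ('X%:A : S) :=
  frac 'X%:A ((repr u).1%:A) (repr u).2.

End Laurent.

Section IdealQuotient.
Variables (K : comNzRingType) (A : comAlgType K) (J : idealr A).

Definition quot_alg := {ideal_quot J}.
HB.instance Definition _ := GRing.ComNzRing.on quot_alg.

Definition quot_scale (c : K) (u : quot_alg) : quot_alg :=
  \pi_quot_alg c%:A * u.

Lemma quot_scaleA b c u : quot_scale b (quot_scale c u) = quot_scale (b * c) u.
Proof.
rewrite /quot_scale mulrA -[\pi_quot_alg _ * _]rmorphM /=.
by rewrite -scalerAl mul1r scalerA.
Qed.

Lemma quot_scale1 : left_id 1 quot_scale.
Proof. by move=> u; rewrite /quot_scale scale1r rmorph1 mul1r. Qed.

Lemma quot_scaleDr : right_distributive quot_scale +%R.
Proof. by move=> c u v; apply: mulrDr. Qed.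

Lemma quot_scaleDl u : {morph quot_scale^~ u : b c / b + c}.
Proof. by move=> b c; rewrite /quot_scale scalerDl rmorphD mulrDl. Qed.

HB.instance Definition _ := GRing.Zmodule_isLmodule.Build K quot_alg
  quot_scaleA quot_scale1 quot_scaleDr quot_scaleDl.

Lemma quot_scaleAl c (u v : quot_alg) : c *: (u * v) = (c *: u) * v.
Proof. exact: mulrA. Qed.

HB.instance Definition _ :=
  GRing.LSemiModule_isLSemiAlgebra.Build K quot_alg quot_scaleAl.
HB.instance Definition _ := GRing.Lalgebra_isComAlgebra.Build K quot_alg.

End IdealQuotient.

Definition alg_iso (K : comNzRingType) (A B : comAlgType K) : Prop :=
  exists f : {lrmorphism A -> B}, bijective f.

(* A possibly improper ideal; idealr requires 1 \notin I. *)
Definition is_ideal (A : comNzRingType) (I : {pred A}) : Prop :=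
  0 \in I /\ forall a, {in I &, forall u v, a * u + v \in I}.

Definition ideal_gen (A : comNzRingType) (E : A -> Prop) (x : A) : Prop :=
  exists n (c g : 'I_n -> A), (forall i, E (g i)) /\ x = \sum_(i < n) c i * g i.

(* S / tS is isomorphic to B as an F-algebra. *)
Definition special_fibre (F : fieldType) (S : comAlgType {poly F})
    (B : comAlgType F) : Prop :=
  exists J : idealr S,
    (forall x : S, x \in J <-> exists y : S, x = 'X *: y) /\
    exists f : {rmorphism quot_alg J -> B},
      bijective f /\ forall (c : F) u, f (c%:P *: u) = c *: f u.

(* S[1/t] is isomorphic to A (x)_F F[t, 1/t] as an F[t, 1/t]-algebra. *)
Definition general_fibre (F : fieldType) (S : comAlgType {poly F})
    (A : comAlgType F) : Prop :=
  exists f : {rmorphism localization ('X%:A : S) -> tensor A (laurent F)},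
    bijective f /\ forall l : laurent F, f (laurent_alg S l) = pure 1 l.

Definition flat_deformation (F : fieldType) (A B : comAlgType F) : Prop :=
  exists S : comAlgType {poly F},
    [/\ flat S, special_fibre S B & general_fibre S A].

Record monomial_order n (lt : rel 'X_{1..n}) : Prop := MonomialOrder {
  mo_irr : irreflexive lt;
  mo_trans : transitive lt;
  mo_total : forall a b, a != b -> lt a b || lt b a;
  mo_add : forall a b c, lt a b -> lt (a + c)%MM (b + c)%MM;
  mo_wf : well_founded lt
}.

Section OrderFunction.
Variables (n : nat) (lt : rel 'X_{1..n}).

(* None stands for the value -oo. *)
Definition olt (x y : option 'X_{1..n}) : bool :=
  match x, y with
  | None, Some _ => true
  | Some a, Some b => lt a b
  | _, None => false
  end.

Definition ole x y := (x == y) || olt x y.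
Definition omax x y := if olt x y then y else x.

Definition oadd (x y : option 'X_{1..n}) : option 'X_{1..n} :=
  if x is Some a then if y is Some b then Some (a + b)%MM else None else None.

Record order_function (F : fieldType) (R : comAlgType F)
    (Gam : 'X_{1..n} -> Prop) (rho : R -> option 'X_{1..n}) : Prop :=
  OrderFunction {
    of_codom : forall f a, rho f = Some a -> Gam a;
    of_surj : forall a, Gam a -> exists f, rho f = Some a;
    of_0 : forall f, rho f = None <-> f = 0;
    of_scale : forall f (c : F), c != 0 -> rho (c *: f) = rho f;
    of_add : forall f g, ole (rho (f + g)) (omax (rho f) (rho g));
    of_sub : forall f g, rho f = rho g -> rho f <> None ->
      exists c : F, c != 0 /\ olt (rho (f - c *: g)) (rho f);
    of_mul : forall f g, rho (f * g) = oadd (rho f) (rho g)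
  }.

End OrderFunction.

Section Toric.
Variables (F : fieldType) (r : nat) (Gam : 'X_{1..r} -> Prop).

(* The F-subalgebra of F[T_1, ..., T_r] generated by the T^g, g in Gam. *)
Definition toric_pred : {pred {mpoly F[r]}} := fun f =>
  `[< forall P : {pred {mpoly F[r]}}, GRing.subalg_closed P ->
        (forall g, Gam g -> 'X_[g] \in P) -> f \in P >].

Lemma toric_closed : GRing.subalg_closed toric_pred.
Proof.
split=> [|c f g /asboolP hf /asboolP hg|f g /asboolP hf /asboolP hg];
  apply/asboolP => P hP PX; have [P1 PD PM] := hP.
- exact: P1.
- by apply: PD; [apply: hf | apply: hg].
- by apply: PM; [apply: hf | apply: hg].
Qed.

Record toric_alg := ToricAlg {
  toric_val : {mpoly F[r]};
  toric_valP : toric_val \in toric_pred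
}.

HB.instance Definition _ := [isSub for toric_val].
HB.instance Definition _ := [Choice of toric_alg by <:].
HB.instance Definition _ := GRing.SubChoice_isSubAlgebra.Build F
  {mpoly F[r]} toric_pred toric_alg (GRing.subalg_closed_semi toric_closed).
HB.instance Definition _ := GRing.SubNzRing_isSubComNzRing.Build
  {mpoly F[r]} toric_pred toric_alg.

End Toric.

Section Weight.
Variables (r s : nat) (M : 'M[nat]_(r, s)).

Definition weight (a : 'X_{1..s}) : 'X_{1..r} :=
  [multinom (\sum_(j < s) M i j * a j)%N | i < r].

Definition col_semigroup (g : 'X_{1..r}) : Prop := exists a, g = weight a.

Definition toric_ideal (F : fieldType) : {mpoly F[s]} -> Prop :=
  ideal_gen (fun f => exists a b, weight a = weight b /\ f = 'X_[a] - 'X_[b]).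

Definition weight_order (lt : rel 'X_{1..r}) (tau : rel 'X_{1..s}) :
    rel 'X_{1..s} :=
  fun a b => lt (weight a) (weight b) || (weight a == weight b) && tau a b.

Definition top_weight_monomials (lt : rel 'X_{1..r}) (F : fieldType)
    (f : {mpoly F[s]}) : seq 'X_{1..s} :=
  [seq a <- msupp f | all (fun b => ~~ lt (weight a) (weight b)) (msupp f)].

Definition rows_independent : Prop :=
  row_free (map_mx (fun k : nat => k%:R : rat) M).

End Weight.

Section Groebner.
Variables (F : fieldType) (s : nat) (lt : rel 'X_{1..s}).
Implicit Types (f g : {mpoly F[s]}) (E : {mpoly F[s]} -> Prop).

Definition is_lead_monomial f (a : 'X_{1..s}) : Prop :=
  a \in msupp f /\ forall b, b \in msupp f -> b != a -> lt b a.

Definition LT_ideal E : {mpoly F[s]} -> Prop :=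
  ideal_gen (fun t =>
    exists f a, [/\ E f, is_lead_monomial f a & t = f@_a *: 'X_[a]]).

Record reduced_groebner_basis (I : {pred {mpoly F[s]}})
    (G : seq {mpoly F[s]}) : Prop := ReducedGroebnerBasis {
  rgb_sub : {subset G <= I};
  rgb_lead : forall f,
    LT_ideal (fun g => g \in I) f <-> LT_ideal (fun g => g \in G) f;
  rgb_monic : forall g, g \in G ->
    exists a, is_lead_monomial g a /\ g@_a = 1;
  rgb_reduced : forall g a, g \in G -> a \in msupp g ->
    ~ LT_ideal (fun h => h \in G /\ h <> g) 'X_[a]
}.

End Groebner.

(* Main.v *)
Require Import Defs.
From HB Require Import structures.
From mathcomp Require Import all_boot all_order all_algebra.
From mathcomp Require Import zify ring lra boolp mpoly.

(* (a) Choose phi_j in R with rho (phi_j) equal to the j-th column of M. The   *)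
(* leading coefficients of the monomials in phi define a character of the     *)
(* lattice ker M, a direct summand of Z^s, so the phi_j can be rescaled until *)
(* phi^a and phi^b have the same leading term whenever M a = M b. One         *)
(* monomial phi^(sg m) per value m of the semigroup gives a basis of R. By    *)
(* Dickson's lemma finitely many relations phi^b = phi^(sg (M b)) + lower     *)
(* terms rewrite every monomial in this basis, and by Gordan's theorem some   *)
(* additive lam : N^r -> N decreases strictly in all of them. The filtration  *)
(* of R by lam then has F[Gamma] as associated graded ring, and its Rees      *)
(* algebra is the required family: it is free over F[t].                      *)
(* (b) The two top monomials of a Groebner basis element make every           *)
(* nonstandard X^a congruent to c X^b + lower weights, c != 0 and b < a of    *)
(* the same weight. So the standard monomials realise each weight of the      *)
(* semigroup exactly once, the largest weight of the normal form is an order  *)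
(* function, and (a) provides the flat deformation.                           *)

Set Implicit Arguments.
Unset Strict Implicit.
Unset Printing Implicit Defensive.

Import Order.TTheory GRing.Theory Num.Theory.
Local Open Scope ring_scope.
Local Open Scope quotient_scope.

(* all_algebra exports another frac. *)
Local Notation frac := Defs.frac.

(** * Dickson's lemma, Gordan's theorem and integer kernels *)

(** Both directions work with coordinates: a basis [e m] of the ring, indexed by the semigroup and
    recorded as an injective linear map [N] into F[T] that sends [e m] to T^m.

    For (a), the aim is that [e a * e b] equals [e (a + b)] plus terms that are smaller for one
    additive weight with values in nat. An order function gives this only up to a nonzero scalar,
    and only for [lt], which does not index a filtration by nat. The scalars disappear in
    [normalised_generators], because the quotients of leading coefficients form a character that
    extends to all exponents. The order is replaced by a weight in [order_domain_flat_deformation]: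
    by [dickson] finitely many rewriting rules suffice, so only finitely many strict inequalities
    have to be kept, and [monomial_order_weight] keeps them by means of [gordan]. In the Rees
    algebra of the weight filtration, setting t = 0 leaves only the top-weight part of each product,
    which is the toric algebra, while inverting t forgets the filtration; [coord_flat_deformation]
    collects this together with flatness. [toric_quotient] is the presentation by binomials.

    For (b), the basis consists of the standard monomials, exactly one for each weight of the
    semigroup. Since every element of [G] has two top-weight monomials, [groebner_reduction] never
    loses the top weight. Hence the normal form of a product of standard monomials leads with the
    sum of their weights, and [coord_order_function] turns leading coordinates into an order
    function. The flat deformation is then an instance of (a). *)

Lemma dickson (n : nat) (P : 'X_{1..n} -> Prop) :
  exists l : seq 'X_{1..n}, (forall b, b \in l -> P b) /\
    forall a, P a -> exists2 b, b \in l & (b <= a)%MM.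
Proof.
suff h k : forall P : 'X_{1..n} -> Prop, exists l : seq 'X_{1..n},
    (forall b, b \in l -> P b) /\
    forall a, P a -> exists2 b, b \in l & forall i : 'I_n, (i < k)%N -> (b i <= a i)%N.
  have [l [lP ldom]] := h n P; exists l; split=> // a /ldom[b bl ba].
  by exists b => //; apply/mnm_lepP => i; apply: ba.
elim: k => {P} [|k IH] P.
  have [[a Pa]|noP] := pselect (exists a, P a).
    by exists [:: a]; split=> [b|b _]; [rewrite inE => /eqP->|exists a; rewrite ?inE].
  by exists [::]; split=> // a Pa; case: noP; exists a.
have [l0 [l0P l0dom]] := IH P.
case: (ltnP k n) => [kn|nk]; last first.
  exists l0; split=> // a /l0dom[b bl ba]; exists b => // i _.
  by apply: ba; apply: leq_trans (ltn_ord i) nk.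
(* Once [a o] reaches [m], the list [l0] for the first [k] coordinates also dominates coordinate
   [o]; each of the finitely many smaller values of [a o] gets the list of its own slice. *)
pose o := Ordinal kn; pose m := (\max_(b <- l0) b o)%N.
have [ls lsP] := choice (fun j => IH (fun a => P a /\ a o = j)).
exists (l0 ++ flatten [seq ls j | j <- iota 0 m]); split=> [b|a Pa].
  rewrite mem_cat => /orP[/l0P//|/flatten_mapP[j _ bj]].
  by have [/(_ _ bj)[]] := lsP j.
have [ma|am] := leqP m (a o).
  have [b bl ba] := l0dom a Pa; exists b; first by rewrite mem_cat bl.
  move=> i; rewrite ltnS leq_eqVlt => /orP[/eqP ik|/ba//].
  have -> : i = o by apply: val_inj.
  by apply: leq_trans ma; rewrite /m (big_rem b) /= ?leq_maxl.
have [_ /(_ a (conj Pa erefl))[b bl ba]] := lsP (a o).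
exists b.
  rewrite mem_cat; apply/orP; right; apply/flatten_mapP; exists (a o) => //.
  by rewrite mem_iota.
move=> i; rewrite ltnS leq_eqVlt => /orP[/eqP ik|/ba//].
have -> : i = o by apply: val_inj.
by have [/(_ _ bl)[_ ->]] := lsP (a o).
Qed.

(* Fourier-Motzkin elimination; the dual certificate is replaced by the cone  *)
(* Pos, which does not contain 0.                                             *)
Lemma gordan (n : nat) (Pos : 'cV[int]_n -> Prop) :
  ~ Pos 0 -> (forall u v, Pos u -> Pos v -> Pos (u + v)) ->
  forall V : seq 'cV[int]_n, (forall v, v \in V -> Pos v) ->
  exists w : 'I_n -> rat,
    forall v, v \in V -> 0 < \sum_i w i * (v i 0)%:~R.
Proof.
move=> Pos0 PosD.
have PosZ (k : nat) v : (0 < k)%N -> Pos v -> Pos (v *+ k).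
  case: k => // k _ Pv; elim: k => [|k IH]; first by rewrite mulr1n.
  by rewrite mulrS; apply: PosD.
suff h k : forall V : seq 'cV[int]_n, (forall v, v \in V -> Pos v) ->
    (forall v (i : 'I_n), v \in V -> (k <= i)%N -> v i 0 = 0) ->
    exists w : 'I_n -> rat, forall v, v \in V -> 0 < \sum_i w i * (v i 0)%:~R.
  move=> V VP; apply: (h n V VP) => v i _; by rewrite leqNgt ltn_ord.
elim: k => [|k IH] V VP V0.
  (* With all coordinates gone, a member of [V] would be 0, which [Pos] excludes. *)
  exists (fun=> 0) => v vV; case: Pos0.
  suff <- : v = 0 by apply: VP.
  by apply/colP => i; rewrite mxE (V0 v).
case: (ltnP k n) => [kn|nk]; last first.
  apply: IH => // v i vV ki; apply: V0 => //.
  by have := ltn_ord i; lia.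
pose o := Ordinal kn.
pose Vp := [seq v : 'cV[int]_n <- V | 0 < v o 0]; pose Vn := [seq v : 'cV[int]_n <- V | v o 0 < 0].
(* For [u] in [Vp] and [v] in [Vn] this positive combination cancels coordinate [o]. *)
pose comb (u v : 'cV[int]_n) := u *+ absz (v o 0) + v *+ absz (u o 0).
pose V' := [seq v : 'cV[int]_n <- V | v o 0 == 0] ++
  [seq comb u v | u <- Vp, v <- Vn].
have comb0 (a b : int) : 0 < a -> b < 0 -> a *+ `|b|%N + b *+ `|a|%N = 0.
  by move=> a0 b0; rewrite !pmulrn !mulrzz; lia.
have V'P v : v \in V' -> Pos v.
  rewrite mem_cat => /orP[|/allpairsP[[x y] /=[]]].
    by rewrite mem_filter => /andP[_ /VP].
  rewrite !mem_filter => /andP[x0 xV] /andP[y0 yV] ->; rewrite /comb.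
  by apply: PosD; apply: PosZ; (try exact: VP); lia.
have V'0 v (i : 'I_n) : v \in V' -> (k <= i)%N -> v i 0 = 0.
  rewrite mem_cat leq_eqVlt => /orP[|/allpairsP[[x y] /=[]]].
    rewrite mem_filter => /andP[/eqP v0 vV] /orP[/eqP ki|ki]; last exact: V0.
    by rewrite -v0; congr (v _ _); apply: val_inj.
  rewrite !mem_filter => /andP[x0 xV] /andP[y0 yV] ->; rewrite /comb => /orP[/eqP ki|ki]; last first.
    by rewrite !(mulmxnE, mxE) !(V0 _ _ _ ki) // !mul0rn.
  have -> : i = o by apply: val_inj.
  by rewrite !(mulmxnE, mxE) comb0.
have [w wP] := IH V' V'P V'0.
pose d (v : 'cV[int]_n) : rat := \sum_(i | i != o) w i * (v i 0)%:~R.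
(* The weight at [o] has to exceed the left side for all [u] in [Vp] and stay below the right side
   for all [v] in [Vn]; positivity on [comb u v] makes these bounds compatible. *)
have key u v : u \in Vp -> v \in Vn ->
    - d u / (u o 0)%:~R < - d v / (v o 0)%:~R.
  move=> uV vV.
  have /wP : comb u v \in V'.
    by rewrite mem_cat; apply/orP; right; apply/allpairsP; exists (u, v).
  move: uV vV; rewrite !mem_filter => /andP[u0 _] /andP[v0 _].
  rewrite (bigD1 o) //= {1}/comb !(mulmxnE, mxE).
  rewrite comb0 // mulr0 add0r.
  have -> : \sum_(i | i != o) w i * ((comb u v) i 0)%:~R
     = (- (v o 0)%:~R) * d u + (u o 0)%:~R * d v.
    rewrite /d !mulr_sumr -big_split /=; apply: eq_bigr => i _.
    rewrite /comb !(mulmxnE, mxE) rmorphD /= !rmorphMn /= -[_ *+ absz (v o 0)]mulr_natr -[_ *+ absz (u o 0)]mulr_natr.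
    have -> : ((absz (v o 0))%:R : rat) = - (v o 0)%:~R.
      by rewrite natr_absz ltr0_norm // rmorphN.
    have -> : ((absz (u o 0))%:R : rat) = (u o 0)%:~R.
      by rewrite natr_absz gtr0_norm.
    ring.
  have u1 : 0 < (u o 0)%:~R :> rat by rewrite ltr0z.
  have v1 : (v o 0)%:~R < 0 :> rat by rewrite ltrz0.
  move=> h; rewrite ltr_pdivrMr // mulrAC ltr_ndivlMr //; lra.
have [c cp cn] : exists2 c : rat,
    (forall u, u \in Vp -> - d u / (u o 0)%:~R < c) &
    (forall v, v \in Vn -> c < - d v / (v o 0)%:~R).
  move: key; move: (Vp) (Vn) => A B.
  pose f v : rat := - d v / (v o 0)%:~R.
  rewrite -/(f _) => key.
  have [c1 c1A c1B] : exists2 c1 : rat, (forall u, u \in A -> f u <= c1) &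
       (forall v, v \in B -> c1 < f v).
    elim: A key => [|a A IHA] key.
      elim: B {key} => [|b B [c _ cB]]; first by exists 0.
      exists (Num.min c (f b - 1)) => // v; rewrite inE => /orP[/eqP->|/cB];
        rewrite gt_min; first by apply/orP; right; lra.
      by move=> ->.
    have [|c cA cB] := IHA; first by move=> u v uA; apply: key; rewrite inE uA orbT.
    exists (Num.max c (f a)) => v.
      by rewrite inE le_max => /orP[/eqP->|/cA->]; rewrite ?lexx ?orbT.
    by move=> vB; rewrite gt_max cB // key // mem_head.
  have [e e0 eB] : exists2 e : rat, 0 < e & (forall v, v \in B -> c1 + e < f v).
    elim: B c1B {key} => [|b B IHB] c1B; first by exists 1.
    have [|e e0 eB] := IHB; first by move=> v vB; apply: c1B; rewrite inE vB orbT.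
    have h : c1 < f b by apply: c1B; rewrite mem_head.
    exists (Num.min e ((f b - c1) / 2)); first by rewrite lt_min e0; lra.
    move=> v; rewrite inE => /orP[/eqP->|/eB vB].
      have : Num.min e ((f b - c1) / 2) <= (f b - c1) / 2 by rewrite ge_min lexx orbT.
      lra.
    have : Num.min e ((f b - c1) / 2) <= e by rewrite ge_min lexx.
    lra.
  exists (c1 + e) => [u uA|v /eB//].
  by apply: le_lt_trans (c1A u uA) _; lra.
exists (fun i => if i == o then c else w i) => v vV.
rewrite (bigD1 o) //= eqxx.
under eq_bigr => i /negbTE -> do [].
rewrite -/(d v); have [v0|v0|v0] := ltgtP (v o 0) 0.
- have vn : v \in Vn by rewrite mem_filter v0.
  have := cn _ vn; rewrite ltr_ndivlMr ?ltrz0 //; lra.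
- have vp : v \in Vp by rewrite mem_filter v0.
  have := cp _ vp; rewrite ltr_pdivrMr ?ltr0z //; lra.
- have /wP : v \in V' by rewrite mem_cat mem_filter v0 eqxx vV.
  by rewrite (bigD1 o) //= v0 !mulr0.
Qed.

(** If [a] were below 0, its multiples 0, a, 2a, ... would descend forever, against
    well-foundedness. *)
Lemma monomial_order_gt0 (n : nat) (lt : rel 'X_{1..n}) :
  monomial_order lt -> forall a, a != 0%MM -> lt 0%MM a.
Proof.
case=> lt_irr lt_trans lt_total ltD lt_wf a a0.
have := lt_total _ _ a0 => /orP[lta0|//].
suff h (x : 'X_{1..n}) k : x = (a *+ k)%MM -> False.
  by case: (h a 1%N); rewrite mulm1n.
elim/(well_founded_ind lt_wf): x k => x IH k xE.
apply: (IH (a *+ k.+1)%MM _ k.+1 erefl); rewrite mulmS xE.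
by have := ltD _ _ (a *+ k)%MM lta0; rewrite add0m.
Qed.

Lemma rat_common_denominator (n : nat) (w : 'I_n -> rat) :
  (forall i, 0 < w i) ->
  exists (d : rat) (c : 'I_n -> nat), 0 < d /\ forall i, w i * d = (c i)%:R.
Proof.
move=> w0; exists (\prod_i (denq (w i))%:~R).
exists (fun i => `|numq (w i)| * \prod_(j | j != i) `|denq (w j)|)%N; split=> [|i].
  by apply: prodr_gt0 => i _; rewrite ltr0z denq_gt0.
rewrite (bigD1 i) //= mulrA -[X in X * _ * _]divq_num_den.
rewrite divfK ?intr_eq0 ?denq_neq0 // natrM natr_absz gtr0_norm ?numq_gt0 //.
congr (_ * _); rewrite natr_prod; apply: eq_bigr => j _.
by rewrite natr_absz gtr0_norm ?denq_gt0.
Qed.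

(* Adding the pairs (0, U_(i)) to V makes the weights positive. *)
Lemma monomial_order_weight (n : nat) (lt : rel 'X_{1..n}) :
  monomial_order lt ->
  forall V : seq ('X_{1..n} * 'X_{1..n}), (forall v, v \in V -> lt v.1 v.2) ->
  exists lam : 'X_{1..n} -> nat,
    (forall a b, lam (a + b)%MM = (lam a + lam b)%N) /\
    (forall v, v \in V -> (lam v.1 < lam v.2)%N).
Proof.
move=> mo V VP; have lt0 := monomial_order_gt0 mo.
case: mo => lt_irr lt_trans lt_total ltD lt_wf.
pose diff (v : 'X_{1..n} * 'X_{1..n}) : 'cV[int]_n :=
  \col_i ((v.2 i)%:Z - (v.1 i)%:Z).
(* Differences of increasing pairs: irreflexivity keeps 0 out, and transitivity with translation
   invariance gives closure under sums. *)
pose Pos u := exists2 v, lt v.1 v.2 & u = diff v.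
have Pos0 : ~ Pos 0.
  case=> [[a b]] /= ltab /colP e; suff ab : a = b by rewrite ab lt_irr in ltab.
  by apply/mnmP => i; have := e i; rewrite !mxE /=; lia.
have PosD u v : Pos u -> Pos v -> Pos (u + v).
  move=> [[a b] /= ab ->] [[c d] /= cd ->]; exists ((a + c)%MM, (b + d)%MM) => /=.
    by apply: lt_trans (ltD _ _ _ ab) _; rewrite ![(b + _)%MM]addmC ltD.
  by apply/colP => i; rewrite !mxE /= !mnmDE; lia.
pose U : seq ('X_{1..n} * 'X_{1..n}) := [seq (0%MM, U_(i)%MM) | i <- enum 'I_n].
have [|w wP] := gordan Pos0 PosD (V := [seq diff v | v <- U ++ V]).
  move=> u /mapP[v + ->]; rewrite mem_cat => /orP[/mapP[i _ ->]|/VP ltv].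
    by exists (0%MM, U_(i)%MM) => //=; apply: lt0; rewrite mnm1_eq0.
  by exists v.
have w0 i : 0 < w i.
  have := wP (diff (0%MM, U_(i)%MM)); rewrite (bigD1 i) //= big1 ?addr0.
    rewrite mxE /= mnm1E mnm0E eqxx subr0 mulr1; apply.
    by apply: map_f; rewrite mem_cat map_f ?mem_enum.
  by move=> j ji; rewrite mxE /= mnm1E mnm0E eq_sym (negbTE ji) subrr mulr0.
have [d [c [d0 cE]]] := rat_common_denominator w0.
exists (fun a => \sum_i c i * a i)%N; split=> [a b|v vV].
  by rewrite -big_split /=; apply: eq_bigr => i _; rewrite mnmDE mulnDr.
have : 0 < (\sum_i w i * (diff v i 0)%:~R) * d.
  by apply: mulr_gt0 => //; apply: wP; apply: map_f; rewrite mem_cat vV orbT.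
rewrite mulr_suml.
rewrite (eq_bigr (fun i => (c i * v.2 i)%:R - (c i * v.1 i)%:R)) => [|i _].
  by rewrite sumrB -!natr_sum subr_gt0 ltr_nat.
by rewrite mulrAC cE mxE rmorphB /= mulrBr -!pmulrn -!natrM.
Qed.

(* Smith normal form: the kernel of an integer matrix is a direct summand.    *)
Lemma int_kernel_projection (m n : nat) (M : 'M[int]_(m, n)) :
  exists P : 'M[int]_n,
    M *m P = 0 /\ forall x : 'cV_n, M *m x = 0 -> P *m x = x.
Proof.
have [L L_unit [R R_unit [d _ ME]]] := int_Smith_normal_form M.
pose D : 'M[int]_(m, n) := \matrix_(i, j) (d`_i *+ (i == j :> nat)).
rewrite -/D in ME.
(* The projection onto the coordinates that [D] kills: those past its last row or with zero
   invariant factor. *)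
pose E : 'M[int]_n := \matrix_(i, j)
  (((i == j) && ((m <= i)%N || (d`_i == 0)))%:R).
exists (invmx R *m E *m R); split=> [|x Mx].
  rewrite ME -!mulmxA mulKVmx // [D *m _]mulmxA.
  suff -> : D *m E = 0 by rewrite mul0mx mulmx0.
  apply/matrixP => i j; rewrite !mxE big1 // => k _; rewrite !mxE.
  have [ik|_] := eqVneq (i : nat) k; last by rewrite mul0r.
  case: (k == j); rewrite ?mulr0 //= -ik leqNgt ltn_ord /=.
  by have [->|_] := eqVneq d`_i 0; rewrite ?mul0r ?mulr0.
have Dy : D *m (R *m x) = 0.
  have : invmx L *m (M *m x) = 0 by rewrite Mx mulmx0.
  by rewrite ME -!mulmxA mulKmx.
rewrite -!mulmxA; suff -> : E *m (R *m x) = R *m x by rewrite mulKmx.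
move: (R *m x) Dy => y Dy; apply/colP => i; rewrite mxE (bigD1 i) //=.
rewrite big1 ?addr0 => [|j ji]; last by rewrite mxE eq_sym (negbTE ji) mul0r.
rewrite mxE eqxx /=; case: leqP => [_|im]; first by rewrite mul1r.
have [_|di] := eqVneq d`_i 0; first by rewrite mul1r.
have := congr1 (fun A : 'cV_m => A (Ordinal im) 0) Dy.
rewrite !mxE (bigD1 i) //= big1 ?addr0 => [|j ji].
  by rewrite mxE eqxx mulr1n => /eqP; rewrite mulf_eq0 (negbTE di) /= => /eqP->; rewrite mulr0.
have /negbTE ij : i != j :> nat by rewrite eq_sym.
by rewrite mxE /= ij mulr0n mul0r.
Qed.

(** * Quotients and flatness *)

Lemma bijective_inj_surj (A B : Type) (f : A -> B) :
  injective f -> (forall y, exists x, f x = y) -> bijective f.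
Proof. by move=> finj /choice[g gK]; exists g => // x; apply: finj. Qed.

Lemma is_ideal_idealr (A : comNzRingType) (I : {pred A}) :
  is_ideal I -> 1 \notin I -> exists J : idealr A, forall f, (f \in J) = (f \in I).
Proof.
case=> I0 ID I1.
pose c : isIdealr A I := isIdealr.Build A I (And3 I0 I1 ID).
by exists (HB.pack_for (idealr A) (I : A -> bool) c).
Qed.

Section QuotientAlgebra.
Variables (K : comNzRingType) (A : comAlgType K) (J : idealr A).
Local Notation pi := (\pi_(quot_alg J) : A -> quot_alg J).

Lemma quot_alg_pi_eq (x y : A) : pi x = pi y <-> x - y \in J.
Proof. by rewrite (rwP eqP) -Quotient.idealrBE. Qed.

Lemma quot_alg_piZ (c : K) (x : A) : c *: pi x = pi (c *: x).
Proof. by rewrite -[in RHS]mulr_algl rmorphM. Qed.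

(** The first isomorphism theorem. *)
Lemma quot_alg_lift (B : comNzRingType) (g : {rmorphism A -> B}) :
  (forall x, x \in J <-> g x = 0) -> (forall y, exists x, g x = y) ->
  exists f : {rmorphism quot_alg J -> B},
    bijective f /\ forall x, f (pi x) = g x.
Proof.
move=> ker surj; pose f (u : quot_alg J) := g (repr u).
have fE x : f (pi x) = g x.
  apply/eqP; rewrite -subr_eq0 -rmorphB; apply/eqP/ker/quot_alg_pi_eq.
  by rewrite reprK.
have f_zmod : zmod_morphism f.
  by move=> u v; rewrite -[u]reprK -[v]reprK -rmorphB !fE rmorphB.
have f_mon : monoid_morphism f.
  split=> [|u v]; first by rewrite -(rmorph1 pi) fE rmorph1.
  by rewrite -[u]reprK -[v]reprK -rmorphM !fE rmorphM.
pose fz := GRing.isZmodMorphism.Build _ _ f f_zmod.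
pose fm := GRing.isMonoidMorphism.Build _ _ f f_mon.
exists (HB.pack_for {rmorphism quot_alg J -> B} f fz fm); split=> //.
apply: bijective_inj_surj => [u v|y] /=; last first.
  by have [x <-] := surj y; exists (pi x).
rewrite -[u]reprK -[v]reprK !fE => e; apply/quot_alg_pi_eq/ker.
by rewrite rmorphB e subrr.
Qed.

Lemma quot_alg_iso (B : comAlgType K) (g : {lrmorphism A -> B}) :
  (forall x, x \in J <-> g x = 0) -> (forall y, exists x, g x = y) ->
  alg_iso (quot_alg J) B.
Proof.
move=> ker surj; have [f [fbij fE]] := quot_alg_lift ker surj.
have f_lin : scalable f.
  by move=> c u; rewrite -[u]reprK quot_alg_piZ !fE /= linearZ.
pose fs := GRing.isScalable.Build K _ _ *:%R f f_lin.
by exists (HB.pack_for {lrmorphism quot_alg J -> B} (f : quot_alg J -> B) fs (GRing.RMorphism.on f)).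
Qed.

End QuotientAlgebra.

(** The class does not depend on the representative, because a bilinear map composed with [f] in its
    first argument stays bilinear. *)
Lemma tensor_mapl_pi (K : comNzRingType) (N N' M : lmodType K) (f : N -> N')
    (s : seq (N * M)) :
  linear f ->
  tensor_mapl f (\pi_(tensor N M) s) =
  \pi_(tensor N' M) [seq (f x.1, x.2) | x <- s].
Proof.
move=> f_lin; apply: tensor_eqP; apply/asboolP => P b [b1 b2].
rewrite !big_map /=.
have /asboolP/(_ P (fun n m => b (f n) m)) := teq_repr s; apply.
split=> [m c x y|n c x y] /=; last exact: b2.
by rewrite f_lin b1.
Qed.

Lemma linear_for_sumZ (K : nzRingType) (N P : lmodType K) (h : N -> P) :
  linear h -> forall (I : Type) (l : seq I) (c : I -> K) (x : I -> N),
  h (\sum_(i <- l) c i *: x i) = \sum_(i <- l) c i *: h (x i).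
Proof.
move=> h_lin I l c x; elim: l => [|i l IH]; last by rewrite !big_cons h_lin IH.
by rewrite !big_nil; have := h_lin (-1) 0 0; rewrite scaler0 addr0 scaleN1r addNr.
Qed.

(** With a dual basis, a tensor is determined by its coordinates in N, and injectivity of [f] can be
    used on each of them. Allowing every larger list [l'] lets all elements that occur be expanded
    over one common list. *)
Lemma flat_of_basis (K : comNzRingType) (M : lmodType K) (I : eqType)
    (co : I -> {linear M -> K^o}) (e : I -> M) :
  (forall x, exists l : seq I, forall l', uniq l' -> {subset l <= l'} ->
     x = \sum_(i <- l') co i x *: e i) ->
  flat M.
Proof.
move=> span N N' f finj u v.
have sum_co (P : lmodType K) (b : N -> M -> P) (s : seq (N * M)) (l : seq I) :
    bilinear_for *:%R *:%R b ->
    (forall x, x \in s -> x.2 = \sum_(i <- l) co i x.2 *: e i) ->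
    \sum_(x <- s) b x.1 x.2 =
    \sum_(i <- l) b (\sum_(x <- s) co i x.2 *: x.1) (e i).
  move=> [b1 b2] sl; under [RHS]eq_bigr => i _ do rewrite (linear_for_sumZ (b1 (e i))).
  rewrite exchange_big /= !big_seq; apply: eq_bigr => x /sl xE.
  by rewrite [X in b _ X]xE (linear_for_sumZ (b2 x.1)).
case/tensorP: u => s; case/tensorP: v => t.
rewrite !tensor_mapl_pi; try exact: linearP.
move=> /eqmodP/asboolP e_st; apply: tensor_eqP; apply/asboolP => P b hb.
(* The map (n, m) -> co i m *: n is bilinear, so it does not separate equal tensors. *)
have e_co i : \sum_(x <- s) co i x.2 *: x.1 = \sum_(x <- t) co i x.2 *: x.1.
  apply: finj; rewrite !linear_sum.
  have /(_ _ (fun n m => co i m *: n)) := e_st; rewrite !big_map /= => h.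
  under eq_bigr do rewrite linearZ; under [RHS]eq_bigr do rewrite linearZ.
  apply: h; split=> [m|n] c x y /=.
    by rewrite scalerDr !scalerA mulrC.
  by rewrite linearP scalerDl scalerA.
have [L LP] := choice span.
pose l := undup (flatten [seq L x.2 | x <- s ++ t]).
have lP x : x \in s ++ t -> x.2 = \sum_(i <- l) co i x.2 *: e i.
  move=> xst; apply: LP => [|i iL]; first exact: undup_uniq.
  by rewrite mem_undup; apply/flatten_mapP; exists x.
rewrite !(sum_co _ _ _ l) //.
- by under eq_bigr do rewrite e_co.
- by move=> x xt; apply: lP; rewrite mem_cat xt orbT.
- by move=> x xt; apply: lP; rewrite mem_cat xt.
Qed.

(** * Rees algebras *)

Record filtration (F : fieldType) (R : comAlgType F) := Filtration {
  fil : nat -> {pred R};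
  fil_lin : forall n (c : F), {in fil n &, forall x y, c *: x + y \in fil n};
  fil_le : forall m n, (m <= n)%N -> {subset fil m <= fil n};
  fil_1 : 1 \in fil 0;
  fil_M : forall m n x y, x \in fil m -> y \in fil n -> x * y \in fil (m + n)
}.

Section Rees.
Variables (F : fieldType) (R : comAlgType F) (G : filtration R).

(** The Rees algebra, the direct sum of the [fil G n] t^n, realised inside R[t]. *)
Definition rees_pred : {pred {poly R}} :=
  fun p => `[< forall n, p`_n \in fil G n >].

Lemma rees_predP (p : {poly R}) :
  reflect (forall n, p`_n \in fil G n) (p \in rees_pred).
Proof. exact: asboolP. Qed.

Lemma fil0 n : 0 \in fil G n.
Proof.
have h : 1 \in fil G n by apply: fil_le (fil_1 G).
by have := fil_lin (-1) h h; rewrite scaleN1r addNr.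
Qed.

Lemma filD n x y : x \in fil G n -> y \in fil G n -> x + y \in fil G n.
Proof. by move=> xG yG; rewrite -[x]scale1r; apply: fil_lin. Qed.

Lemma filZ n (c : F) x : x \in fil G n -> c *: x \in fil G n.
Proof. by move=> xG; rewrite -[_ *: _]addr0 fil_lin ?fil0. Qed.

Lemma fil_sum n (I : Type) (l : seq I) (P : pred I) (f : I -> R) :
  (forall i, P i -> f i \in fil G n) -> \sum_(i <- l | P i) f i \in fil G n.
Proof. by move=> h; elim/big_rec: _ => [|i x Pi xG]; rewrite ?fil0 ?filD ?h. Qed.

Lemma rees_closed : GRing.subring_closed rees_pred.
Proof.
split=> [|p q /rees_predP hp /rees_predP hq|p q /rees_predP hp /rees_predP hq];
  apply/rees_predP => n.
- by rewrite coef1; case: n => [|n] /=; rewrite ?fil_1 ?fil0.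
- by rewrite coefB -scaleN1r addrC fil_lin.
- rewrite coefM; apply: fil_sum => i _.
  have := fil_M (hp i) (hq (n - i)%N); by rewrite subnKC // -ltnS.
Qed.

Record rees := MkRees { rees_val : {poly R}; rees_valP : rees_val \in rees_pred }.

HB.instance Definition _ := [isSub for rees_val].
HB.instance Definition _ := [Choice of rees by <:].
HB.instance Definition _ := GRing.SubChoice_isSubComNzRing.Build
  {poly R} rees_pred rees rees_closed.

(** F[t] acts through R[t]; multiplication by t raises degrees, which is harmless because the
    filtration increases. *)
Lemma rees_scale_proof (c : {poly F}) (p : rees) :
  map_poly (in_alg R) c * rees_val p \in rees_pred.
Proof.
apply/rees_predP => n; rewrite coefM; apply: fil_sum => i _.
rewrite coef_map /= mulr_algl filZ //; apply: fil_le (leq_subr i n) _ _.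
by case: p => p /= /rees_predP.
Qed.

Definition rees_scale c p := MkRees (rees_scale_proof c p).

Lemma rees_scaleA b c p : rees_scale b (rees_scale c p) = rees_scale (b * c) p.
Proof. by apply: val_inj; rewrite /= rmorphM /= mulrA. Qed.

Lemma rees_scale1 : left_id 1 rees_scale.
Proof. by move=> p; apply: val_inj; rewrite /= rmorph1 mul1r. Qed.

Lemma rees_scaleDr : right_distributive rees_scale +%R.
Proof. by move=> c p q; apply: val_inj; rewrite /= mulrDr. Qed.

Lemma rees_scaleDl p : {morph rees_scale^~ p : b c / b + c}.
Proof. by move=> b c; apply: val_inj; rewrite /= rmorphD mulrDl. Qed.

HB.instance Definition _ := GRing.Zmodule_isLmodule.Build {poly F} rees
  rees_scaleA rees_scale1 rees_scaleDr rees_scaleDl.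

Lemma rees_scaleAl c (p q : rees) : c *: (p * q) = (c *: p) * q.
Proof. by apply: val_inj; rewrite /= mulrA. Qed.

HB.instance Definition _ :=
  GRing.LSemiModule_isLSemiAlgebra.Build {poly F} rees rees_scaleAl.
HB.instance Definition _ := GRing.Lalgebra_isComAlgebra.Build {poly F} rees.

Lemma rees_valD p q : rees_val (p + q) = rees_val p + rees_val q.
Proof. by []. Qed.
Lemma rees_valB p q : rees_val (p - q) = rees_val p - rees_val q.
Proof. by []. Qed.
Lemma rees_valM p q : rees_val (p * q) = rees_val p * rees_val q.
Proof. by []. Qed.
Lemma rees_val1 : rees_val 1 = 1.
Proof. by []. Qed.
Lemma rees_valZ c p : rees_val (c *: p) = map_poly (in_alg R) c * rees_val p.
Proof. by []. Qed.

End Rees.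

(** * Tensors with Laurent polynomials and the general fibre *)

Section PureTensors.
Variables (K : comNzRingType) (N M : lmodType K).
Implicit Types (n : N) (m : M).

Lemma pureDl m : {morph (fun n => pure n m) : x y / x + y : N >-> x + y : tensor N M}.
Proof.
move=> x y; rewrite [RHS]tensor_addE; apply: tensor_eqP; apply/asboolP.
move=> P b [b1 b2]; rewrite !big_cons !big_nil /= !addr0.
by have /= := b1 m 1 x y; rewrite !scale1r => ->.
Qed.

Lemma pureDr n : {morph pure n : x y / x + y : M >-> x + y : tensor N M}.
Proof.
move=> x y; rewrite [RHS]tensor_addE; apply: tensor_eqP; apply/asboolP.
move=> P b [b1 b2]; rewrite !big_cons !big_nil /= !addr0.
by have /= := b2 n 1 x y; rewrite !scale1r => ->.
Qed.

Lemma pure0l m : pure 0 m = 0 :> tensor N M.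
Proof. by apply: (addIr (pure 0 m)); rewrite -pureDl !add0r. Qed.

Lemma pure0r n : pure n 0 = 0 :> tensor N M.
Proof. by apply: (addIr (pure n 0)); rewrite -pureDr !add0r. Qed.

Lemma pure_sumr n (I : Type) (l : seq I) (f : I -> M) :
  pure n (\sum_(i <- l) f i) = \sum_(i <- l) pure n (f i).
Proof. exact: (big_morph (pure n) (pureDr n) (pure0r n)). Qed.

Lemma pureZ c n m : pure (c *: n) m = pure n (c *: m).
Proof.
apply: tensor_eqP; apply/asboolP => P b [b1 b2]; rewrite !big_seq1 /=.
have := linear_for_sumZ (b1 m) [:: tt] (fun=> c) (fun=> n); rewrite !big_seq1 => ->.
by have := linear_for_sumZ (b2 n) [:: tt] (fun=> c) (fun=> m); rewrite !big_seq1 => ->.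
Qed.

Lemma tensor_sum_pure (s : seq (N * M)) :
  \pi_(tensor N M) s = \sum_(x <- s) pure x.1 x.2.
Proof.
elim: s => [|x s IH]; first by rewrite big_nil.
by rewrite big_cons -IH [RHS]tensor_addE /= -surjective_pairing.
Qed.

(** The universal property of the tensor product, in additive form. *)
Lemma tensor_elim (P : lmodType K) (b : N -> M -> P) :
  bilinear_for *:%R *:%R b ->
  exists h : tensor N M -> P,
    {morph h : x y / x + y} /\ forall n m, h (pure n m) = b n m.
Proof.
move=> hb; pose h (u : tensor N M) := \sum_(x <- repr u) b x.1 x.2.
have hE s : h (\pi_(tensor N M) s) = \sum_(x <- s) b x.1 x.2.
  by have /asboolP/(_ P b hb) := teq_repr s.
exists h; split=> [u v|n m]; last by rewrite hE big_seq1.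
case/tensorP: u => s; case/tensorP: v => t.
by rewrite [_ + _ in LHS]tensor_addE !hE big_cat.
Qed.

End PureTensors.

Lemma pureM (K : comNzRingType) (A B : comAlgType K) (a a' : A) (b b' : B) :
  pure a b * pure a' b' = pure (a * a') (b * b') :> tensor A B.
Proof. exact: tensor_mulE. Qed.

Section FracArith.
Variables (A : comNzRingType) (a : A).
Implicit Types x y : A.

Lemma fracD x m y n :
  frac a x m + frac a y n = frac a (a ^+ n * x + a ^+ m * y) (m + n).
Proof. exact: loc_addE. Qed.

Lemma fracN x m : - frac a x m = frac a (- x) m.
Proof. exact: loc_oppE. Qed.

Lemma fracM x m y n : frac a x m * frac a y n = frac a (x * y) (m + n).
Proof. exact: loc_mulE. Qed.

End FracArith.

Section LaurentCoef.
Variable F : fieldType.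

(** The coefficient of t^i for i at least 0: in q / t^m it is the coefficient of q in degree m +
    i. *)
Definition lcoef (i : nat) (l : laurent F) : F := (repr l).1`_((repr l).2 + i).

Lemma lcoefE i q m : lcoef i (frac 'X q m) = q`_(m + i).
Proof.
rewrite /lcoef; have [k] := repr_frac 'X q m.
move: (repr _) => -[q' m'] /= /(congr1 (fun p : {poly F} => p`_(k + m + m' + i))).
rewrite !mulrA -!exprD !coefXnM.
have -> : (k + m + m' + i < k + m = false)%N by lia.
have -> : (k + m + m' + i < k + m' = false)%N by lia.
have -> : (k + m + m' + i - (k + m) = m' + i)%N by lia.
by have -> : (k + m + m' + i - (k + m') = m + i)%N by lia.
Qed.

Lemma fracZ (c : F) q m : c *: (frac 'X q m : laurent F) = frac 'X (c *: q) m.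
Proof. by rewrite -mul_polyC -[m in RHS]add0n -fracM. Qed.

Lemma lcoef_linear i : linear (lcoef i : laurent F -> F^o).
Proof.
move=> c u v; case: (@Defs.fracP _ 'X u) => p m; case: (@Defs.fracP _ 'X v) => q n.
rewrite fracZ fracD !lcoefE coefD !coefXnM.
have -> : (m + n + i < n = false)%N by lia.
have -> : (m + n + i < m = false)%N by lia.
have -> : (m + n + i - n = m + i)%N by lia.
have -> : (m + n + i - m = n + i)%N by lia.
by rewrite coefZ.
Qed.

Lemma frac_poly (q : {poly F}) m :
  frac 'X q m = frac 'X q 0 * frac 'X 1 m :> laurent F.
Proof. by rewrite fracM mulr1 add0n. Qed.

Lemma frac_sum (I : Type) (l : seq I) (f : I -> {poly F}) :
  frac 'X (\sum_(i <- l) f i) 0 = \sum_(i <- l) frac 'X (f i) 0 :> laurent F.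
Proof.
apply: (big_morph (fun p => frac 'X p 0 : laurent F)) => // p q.
by rewrite loc_inP.
Qed.

End LaurentCoef.

Section GeneralFibre.
Variables (F : fieldType) (R : comAlgType F) (G : filtration R).
Local Notation T := (tensor R (laurent F)).
Local Notation t := ('X%:A : rees G).

Definition poly_tensor (p : {poly R}) : T :=
  \sum_(i < size p) pure p`_i (frac 'X 'X^i 0 : laurent F).
Local Notation H := poly_tensor.

Lemma poly_tensor_widen n (p : {poly R}) : (size p <= n)%N ->
  H p = \sum_(i < n) pure p`_i (frac 'X 'X^i 0 : laurent F).
Proof.
move=> pn; rewrite /poly_tensor (big_ord_widen _ (fun i => pure p`_i (frac 'X 'X^i 0 : laurent F)) pn).
rewrite big_mkcond /=; apply: eq_bigr => i _; case: ltnP => // ip.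
by rewrite nth_default // pure0l.
Qed.

Lemma poly_tensorD : {morph H : p q / p + q}.
Proof.
move=> p q; pose n := maxn (size p) (size q).
rewrite (@poly_tensor_widen n (p + q)) ?size_polyD //.
rewrite (@poly_tensor_widen n p) ?leq_maxl // (@poly_tensor_widen n q) ?leq_maxr //.
by rewrite -big_split /=; apply: eq_bigr => i _; rewrite coefD pureDl.
Qed.

Lemma poly_tensor0 : H 0 = 0.
Proof. by rewrite /poly_tensor size_poly0 big_ord0. Qed.

Lemma poly_tensor_sum (I : Type) (l : seq I) (f : I -> {poly R}) :
  H (\sum_(i <- l) f i) = \sum_(i <- l) H (f i).
Proof. exact: (big_morph H poly_tensorD poly_tensor0). Qed.

Lemma poly_tensorZX a i : H (a *: 'X^i) = pure a (frac 'X 'X^i 0 : laurent F).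
Proof.
rewrite (@poly_tensor_widen i.+1); last first.
  by apply: leq_trans (size_scale_leq _ _) _; rewrite size_polyXn.
rewrite big_ord_recr /= coefZ coefXn eqxx mulr1 big1 ?add0r // => j _.
by rewrite coefZ coefXn ltn_eqF // mulr0 pure0l.
Qed.

Lemma poly_tensorM : {morph H : p q / p * q}.
Proof.
move=> p q; rewrite -{1}[p]coefK -{1}[q]coefK !poly_def mulr_suml.
rewrite poly_tensor_sum [H p in RHS]/poly_tensor mulr_suml.
apply: eq_bigr => i _; rewrite mulr_sumr poly_tensor_sum /poly_tensor mulr_sumr.
apply: eq_bigr => j _; rewrite -scalerAl -scalerAr scalerA -exprD.
by rewrite -/(H _) poly_tensorZX pureM fracM exprD.
Qed.

Lemma poly_tensorC (q : {poly F}) :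
  H (map_poly (in_alg R) q) = pure 1 (frac 'X q 0 : laurent F).
Proof.
rewrite -[q in RHS]coefK poly_def frac_sum /poly_tensor size_map_poly pure_sumr.
apply: eq_bigr => i _.
by rewrite coef_map /= pureZ fracZ.
Qed.

(** The bilinear map (a, l) -> lcoef i l *: a reads the coefficient of t^i back from the tensor. *)
Lemma poly_tensor_inj : injective H.
Proof.
move=> p q e; apply/polyP => i.
pose b (a : R) (l : laurent F) : R := lcoef i l *: a.
have [|h [hD hE]] := @tensor_elim F R (laurent F) R b.
  split=> [m|n] c x y; rewrite /b.
    by rewrite scalerDr scalerA mulrC -scalerA.
  by rewrite (lcoef_linear i c x y) scalerDl -scalerA.
have h0 : h 0 = 0 by apply: (addIr (h 0)); rewrite -hD !add0r.
suff hH (s : {poly R}) : h (H s) = s`_i by rewrite -!hH e.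
rewrite (@poly_tensor_widen (maxn (size s) i.+1)) ?leq_maxl //.
rewrite (big_morph h hD h0) (bigD1 (Ordinal (leq_maxr (size s) i.+1))) //= big1.
  by rewrite hE /b lcoefE coefXn eqxx scale1r addr0.
move=> j ji; rewrite hE /b lcoefE coefXn add0n.
have /negbTE -> : i != j :> nat by rewrite eq_sym.
by rewrite scale0r.
Qed.

Let tau : T := pure 1 (frac 'X 'X 0 : laurent F).
Let tau' : T := pure 1 (frac 'X 1 1 : laurent F).

Lemma tauK : tau * tau' = 1.
Proof.
rewrite /tau /tau' pureM mulr1; congr pure.
by rewrite fracM mulr1 add0n; apply/frac_eqP; exists 0%N; rewrite !mulr1 mul1r.
Qed.

Lemma tau'E m : tau' ^+ m = pure 1 (frac 'X 1 m : laurent F).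
Proof.
elim: m => [|m IH]; first by rewrite expr0.
by rewrite exprS IH pureM mul1r fracM mulr1.
Qed.

Lemma poly_tensorX k : H 'X^k = tau ^+ k.
Proof.
have HX : H 'X = tau.
  by have := poly_tensorC 'X; rewrite map_polyX.
elim: k => [|k IH]; last by rewrite !exprS poly_tensorM IH HX.
by have := poly_tensorC 1; rewrite rmorph1 expr0.
Qed.

Lemma rees_val_t k : rees_val (t ^+ k) = 'X^k.
Proof.
elim: k => [|k IH]; first by rewrite !expr0.
by rewrite exprS rees_valM IH rees_valZ mulr1 map_polyX exprS.
Qed.

(** Once t is invertible the filtration disappears: an element x of level n is the fraction (x t^n)
    / t^n, so the localisation is all of R[t, 1/t]. Exhaustiveness provides such an n for every
    x. *)
Lemma rees_general_fibre :
  (forall x : R, exists n, x \in fil G n) -> general_fibre (rees G) R.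
Proof.
move=> exh.
pose f (u : localization t) : T := H (rees_val (repr u).1) * tau' ^+ (repr u).2.
have shift p k m : H (rees_val (t ^+ k * p)) * tau' ^+ (k + m)%N =
    H (rees_val p) * tau' ^+ m.
  rewrite rees_valM rees_val_t poly_tensorM poly_tensorX exprD.
  by rewrite mulrACA -exprMn tauK expr1n mul1r.
have fE p m : f (frac t p m) = H (rees_val p) * tau' ^+ m.
  rewrite /f; have [k] := repr_frac t p m; move: (repr _) => -[p' m'] /=.
  rewrite !mulrA -!exprD => e.
  by rewrite -(shift p' (k + m)%N) -(shift p (k + m')%N) e; congr (_ * _ ^+ _); lia.
have f_zmod : zmod_morphism f.
  move=> u v; case/Defs.fracP: u => p m; case/Defs.fracP: v => q n.
  rewrite fracN fracD !fE rees_valD poly_tensorD.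
  rewrite mulrDl shift addnC shift; congr (_ + _); rewrite -mulNr; congr (_ * _).
  apply: (addrI (H (rees_val q))); rewrite -poly_tensorD -rees_valD subrr.
  by rewrite subrr poly_tensor0.
have f_mon : monoid_morphism f.
  split=> [|u v].
    rewrite -[f 1]/(f (frac t 1 0)) fE mulr1 rees_val1.
    by have := poly_tensorX 0; rewrite !expr0.
  case/Defs.fracP: u => p m; case/Defs.fracP: v => q n.
  by rewrite fracM !fE rees_valM poly_tensorM exprD mulrACA.
pose fz := GRing.isZmodMorphism.Build _ _ f f_zmod.
pose fm := GRing.isMonoidMorphism.Build _ _ f f_mon.
pose fR := HB.pack_for {rmorphism localization t -> T} f fz fm.
exists fR; split; last first.
  move=> l; rewrite -[fR _]/(f _) /laurent_alg fE tau'E rees_valZ mulr1.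
  rewrite poly_tensorC pureM mulr1 -frac_poly; congr pure.
  by rewrite /frac -surjective_pairing reprK.
apply: (@bijective_inj_surj _ _ f) => [u v|y].
  case/Defs.fracP: u => p m; case/Defs.fracP: v => q n; rewrite !fE => e.
  apply/frac_eqP; exists 0%N; rewrite !mul1r; apply: val_inj => /=.
  apply: poly_tensor_inj.
  (* It suffices to compare after multiplication by the unit [tau' ^+ (n + m)], where [shift]
     applies. *)
  apply: (can_inj (g := fun x => x * tau ^+ (n + m))
    (f := fun x => x * tau' ^+ (n + m))) => [x|].
    by rewrite -mulrA -exprMn [tau' * _]mulrC tauK expr1n mulr1.
  by rewrite [LHS]shift e addnC [RHS]shift.
have f0 : f 0 = 0 by have := f_zmod 0 0; rewrite !subrr.
have fD u v : f (u + v) = f u + f v.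
  by have := f_zmod u (- v); have := f_zmod 0 v; rewrite f0 !sub0r opprK => -> ->; rewrite opprK.
case/tensorP: y => s; rewrite tensor_sum_pure.
elim: s => [|[a l] s [u IH]]; first by exists 0; rewrite big_nil.
suff [v vE] : exists v, f v = pure a l by exists (v + u); rewrite fD vE IH big_cons.
case: (@Defs.fracP _ 'X l) => q m; have [n an] := exh a.
have aP : a *: 'X^n \in rees_pred G.
  apply/rees_predP => i; rewrite coefZ coefXn.
  by case: eqVneq => [->|_]; rewrite ?mulr1 // mulr0 fil0.
(* The tensor of a and q / t^m is the image of q (a t^n) / t^(n + m), where [n] is a level of
   [a]. *)
exists (frac t (q *: MkRees aP) (n + m)); rewrite fE rees_valZ poly_tensorM /=.
rewrite poly_tensorC poly_tensorZX pureM mul1r tau'E pureM mulr1; congr pure.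
rewrite [X in X * _](fracM 'X q 0 'X^n 0) [LHS]fracM; apply/frac_eqP; exists 0%N.
by rewrite !mul1r mulr1 !add0n exprD [q * _]mulrC !mulrA ['X^m * _]mulrC.
Qed.

End GeneralFibre.

Lemma mcoeff_sum_monomials (F : fieldType) (n : nat) (l : seq 'X_{1..n})
    (c : 'X_{1..n} -> F) (m : 'X_{1..n}) :
  uniq l ->
  (\sum_(k <- l) c k *: 'X_[k] : {mpoly F[n]})@_m = if m \in l then c m else 0.
Proof.
move=> l_uniq; rewrite raddf_sum /=; case: ifPn => ml.
  rewrite (bigD1_seq m) //= mcoeffZ mcoeffX eqxx mulr1 big1 ?addr0 // => k km.
  by rewrite mcoeffZ mcoeffX (negbTE km) mulr0.
rewrite big_seq big1 // => k kl; rewrite mcoeffZ mcoeffX.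
by case: eqVneq => [km|_]; rewrite ?mulr0 //; rewrite -km kl in ml.
Qed.

(** Since [Gam] is a submonoid, the polynomials supported on it already form a subalgebra, and each
    of them is a combination of generators. *)
Lemma toric_predP (F : fieldType) (r : nat) (Gam : 'X_{1..r} -> Prop)
    (f : {mpoly F[r]}) :
  Gam 0%MM -> (forall a b, Gam a -> Gam b -> Gam (a + b)%MM) ->
  f \in toric_pred Gam <-> (forall m, m \in msupp f -> Gam m).
Proof.
move=> Gam0 GamD; split=> [/asboolP h|h].
  pose P : {pred {mpoly F[r]}} := fun p => `[< forall m, m \in msupp p -> Gam m >].
  have : f \in P; last by move=> /asboolP.
  apply: h => [|g Gg]; last first.
    by apply/asboolP => m; rewrite msuppX inE => /eqP->.
  split=> [|c p q /asboolP hp /asboolP hq|p q /asboolP hp /asboolP hq];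
    apply/asboolP => m.
  - by rewrite msupp1 inE => /eqP->.
  - move=> /msuppD_le; rewrite mem_cat => /orP[/msuppZ_le|]; [exact: hp|exact: hq].
  - by move=> /msuppM_le/allpairsP[[a b] /= [/hp aG /hq bG ->]]; apply: GamD.
rewrite [f]mpolyE; apply/asboolP => P hP PX.
have [P1 PL PM] := hP; have P0 : 0 \in P.
  by have := PL (-1) _ _ P1 P1; rewrite scaleN1r addNr.
rewrite big_seq; elim/big_rec: _ => // m p mf pP.
by apply: PL => //; apply/PX/h.
Qed.

(** * Degeneration along an additive weight *)

Section Degeneration.
Variables (F : fieldType) (r : nat) (Gam : 'X_{1..r} -> Prop).
Hypotheses (Gam0 : Gam 0%MM).
Hypothesis (GamD : forall a b, Gam a -> Gam b -> Gam (a + b)%MM).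
Variables (R : comAlgType F) (e : 'X_{1..r} -> R).
Variables (N : {linear R -> {mpoly F[r]}}) (lam : 'X_{1..r} -> nat).
Hypothesis N_inj : injective N.
Hypothesis N_supp : forall x m, m \in msupp (N x) -> Gam m.
Hypothesis N_e : forall m, Gam m -> N (e m) = 'X_[m].
Hypothesis e0 : e 0%MM = 1.
Hypothesis lamD : forall a b, lam (a + b)%MM = (lam a + lam b)%N.
(** The product [e a * e b] is [e (a + b)] up to corrections of strictly smaller [lam]. *)
Hypothesis N_M : forall a b m, Gam a -> Gam b -> (lam (a + b)%MM <= lam m)%N ->
  (N (e a * e b))@_m = (m == (a + b)%MM)%:R.

(** Extension of [e] by zero, so that expansions may run over lists of exponents that leave
    [Gam]. *)
Let eG m : R := if `[< Gam m >] then e m else 0.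

Lemma coord_expand x (l : seq 'X_{1..r}) :
  uniq l -> {subset msupp (N x) <= l} -> x = \sum_(m <- l) (N x)@_m *: eG m.
Proof.
move=> l_uniq sub; apply: N_inj; rewrite linear_sum /=.
under eq_bigr => m _.
  have -> : N ((N x)@_m *: eG m) = (N x)@_m *: 'X_[m].
    rewrite linearZ /= /eG; case: asboolP => [/N_e->//|Gm].
    have -> : (N x)@_m = 0; last by rewrite !scale0r.
    by apply/eqP; rewrite mcoeff_eq0; apply/negP => /N_supp.
  over.
apply/mpolyP => m; rewrite mcoeff_sum_monomials //; case: ifPn => // ml.
by apply/eqP; rewrite mcoeff_eq0; apply: contra ml => /sub.
Qed.

(** By [N_M], applied to each product of basis elements, multiplication in R agrees in top weight
    with multiplication of coordinate polynomials. *)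
Lemma coordM_top x y i j m :
  (forall k, k \in msupp (N x) -> (lam k <= i)%N) ->
  (forall k, k \in msupp (N y) -> (lam k <= j)%N) ->
  (i + j <= lam m)%N -> (N (x * y))@_m = (N x * N y)@_m.
Proof.
move=> xi yj ijm.
rewrite {1}(coord_expand (msupp_uniq (N x)) (fun k => id)).
rewrite {1}(coord_expand (msupp_uniq (N y)) (fun k => id)).
rewrite [in RHS](mpolyE (N x)) [in RHS](mpolyE (N y)) !mulr_suml linear_sum !raddf_sum /=.
rewrite big_seq [RHS]big_seq; apply: eq_bigr => a ax; rewrite !mulr_sumr linear_sum !raddf_sum /=.
rewrite big_seq [RHS]big_seq; apply: eq_bigr => b bx.
rewrite -!scalerAl -!scalerAr !linearZ /=; congr (_ * (_ * _)).
have Ga := N_supp ax; have Gb := N_supp bx.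
rewrite /eG !asboolT // N_M //; last first.
  by apply: leq_trans ijm; rewrite lamD leq_add ?xi ?yj.
by rewrite -mpolyXD mcoeffX eq_sym.
Qed.

Lemma lam0 : lam 0%MM = 0%N.
Proof. by have := lamD 0%MM 0%MM; rewrite addm0; lia. Qed.

Let fl n : {pred R} :=
  fun x => `[< forall m, m \in msupp (N x) -> (lam m <= n)%N >].

Lemma flP n x :
  reflect (forall m, m \in msupp (N x) -> (lam m <= n)%N) (x \in fl n).
Proof. exact: asboolP. Qed.

Lemma coord1 : N 1 = 'X_[0%MM].
Proof. by rewrite -e0 N_e. Qed.

Lemma fl_lin n (c : F) : {in fl n &, forall x y, c *: x + y \in fl n}.
Proof.
move=> x y /flP hx /flP hy; apply/flP => m; rewrite linearP => /msuppD_le.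
by rewrite mem_cat => /orP[/msuppZ_le/hx|/hy].
Qed.

Lemma fl_le m n : (m <= n)%N -> {subset fl m <= fl n}.
Proof.
by move=> mn x /flP hx; apply/flP => k /hx km; apply: leq_trans km mn.
Qed.

Lemma fl_1 : 1 \in fl 0.
Proof. by apply/flP => m; rewrite coord1 msuppX inE => /eqP->; rewrite lam0. Qed.

Lemma fl_M m n x y : x \in fl m -> y \in fl n -> x * y \in fl (m + n).
Proof.
move=> /flP hx /flP hy; apply/flP => k; rewrite leqNgt; apply: contraLR.
rewrite negbK => mnk; rewrite -mcoeff_eq0 (coordM_top hx hy) ?(ltnW mnk) //.
rewrite mcoeff_eq0; apply/negP => /msuppM_le/allpairsP[[a b] /= [/hx am /hy bn kE]].
by move: mnk; rewrite kE lamD; lia.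
Qed.

Let G := Filtration fl_lin fl_le fl_1 fl_M.
Local Notation S := (rees G).

Lemma rees_coef (p : S) n m :
  m \in msupp (N (rees_val p)`_n) -> (lam m <= n)%N.
Proof. by case: p => p /= /rees_predP/(_ n)/flP; apply. Qed.

Lemma rees_coef0 (p : S) n m : (n < lam m)%N -> (N (rees_val p)`_n)@_m = 0.
Proof.
by rewrite ltnNge => h; apply/eqP; rewrite mcoeff_eq0; apply: contra h => /rees_coef.
Qed.

Lemma coef_rees_scale c (p : S) n :
  (rees_val (c *: p))`_n = \sum_(i < n.+1) c`_i *: (rees_val p)`_(n - i).
Proof.
rewrite rees_valZ coefM; apply: eq_bigr => i _.
by rewrite coef_map /= mulr_algl.
Qed.

Lemma coef_rees_scaleX (p : S) n :
  (rees_val ('X *: p))`_n = if n is n'.+1 then (rees_val p)`_n' else 0.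
Proof. by rewrite rees_valZ map_polyX coefXM; case: n. Qed.

(** The elements [eG m] t^(lam m) form a basis over F[t]. The coordinate [co m] collects the
    coefficients at [m] of all degrees, shifted down by [lam m]; below degree [lam m] they
    vanish. *)
Lemma rees_flat : flat S.
Proof.
pose co m (p : S) : {poly F} :=
  \poly_(i < size (rees_val p)) (N (rees_val p)`_(i + lam m))@_m.
have coE m p i : (co m p)`_i = (N (rees_val p)`_(i + lam m))@_m.
  rewrite coef_poly; case: ltnP => // pi.
  by rewrite nth_default ?linear0 ?mcoeff0 //; apply: leq_trans pi (leq_addr _ _).
have co_lin m : linear (co m : S -> {poly F}^o).
  move=> c p q; apply/polyP => i; rewrite coE [RHS]coefD coE.
  rewrite rees_valD coefD linearD mcoeffD; congr (_ + _).
  rewrite coef_rees_scale linear_sum raddf_sum /= coefM.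
  rewrite [RHS](big_ord_widen (i + lam m).+1
    (fun j => c`_j * (co m p)`_(i - j))) ?ltnS ?leq_addr //.
  rewrite [RHS]big_mkcond /=; apply: eq_bigr => j _.
  rewrite linearZ /= mcoeffZ; case: ltnP => ji.
    by rewrite coE; congr (c`_ _ * (N _`_ _)@_m); lia.
  (* For j > i the coefficient is taken in degree i + lam m - j, which is below lam m. *)
  by rewrite rees_coef0 ?mulr0 //; have := ltn_ord j; lia.
have e_mem m : eG m *: 'X^(lam m) \in rees_pred G.
  apply/rees_predP => n; rewrite coefZ coefXn; case: eqVneq => [->|_]; last first.
    by rewrite mulr0 fil0.
  rewrite mulr1; apply/flP => k; rewrite /eG; case: asboolP => [Gm|_].
    by rewrite N_e // msuppX inE => /eqP->.
  by rewrite linear0 msupp0.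
pose coL m : {linear S -> {poly F}^o} := HB.pack_for {linear S -> {poly F}^o}
  (co m : S -> {poly F}^o) (GRing.isLinear.Build _ _ _ _ (co m) (co_lin m)).
apply: (@flat_of_basis _ _ _ coL (fun m => MkRees (e_mem m))) => p.
exists (flatten [seq msupp (N (rees_val p)`_n) | n <- iota 0 (size (rees_val p))]).
move=> l l_uniq sub; apply: val_inj; apply/polyP => n /=.
rewrite -[rees_val (\sum_(_ <- _) _)]/(val _) raddf_sum coef_sum /=.
have sub_n : {subset msupp (N (rees_val p)`_n) <= l}.
  move=> m mn; apply: sub; apply/flatten_mapP; exists n => //.
  rewrite mem_iota add0n /=; case: ltnP => // pn.
  by rewrite nth_default // linear0 msupp0 in mn.
rewrite [LHS](coord_expand l_uniq sub_n); apply: eq_bigr => m _.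
rewrite -scalerAr coefZ coefMXn; case: ltnP => [nm|mn].
  by rewrite rees_coef0 // scale0r mulr0.
by rewrite coef_map /= coE subnK // mulrC mulr_algl.
Qed.

(** The symbol map: of the t^n coefficient only the part of weight exactly n is kept, that is, its
    class in the associated graded ring. *)
Definition initial_form (p : S) : {mpoly F[r]} :=
  \sum_(n < size (rees_val p))
    \sum_(m <- msupp (N (rees_val p)`_n) | lam m == n)
      (N (rees_val p)`_n)@_m *: 'X_[m].

Lemma mcoeff_initial_form p m :
  (initial_form p)@_m = (N (rees_val p)`_(lam m))@_m.
Proof.
rewrite raddf_sum /=.
have E (n : nat) : (\sum_(k <- msupp (N (rees_val p)`_n) | lam k == n)
      (N (rees_val p)`_n)@_k *: 'X_[k] : {mpoly F[r]})@_m =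
    if lam m == n then (N (rees_val p)`_n)@_m else 0.
  rewrite -big_filter mcoeff_sum_monomials ?filter_uniq ?msupp_uniq //.
  rewrite mem_filter; case: eqP => //= _; case: ifPn => // h.
  by apply/esym/eqP; rewrite mcoeff_eq0.
under eq_bigr => n _ do rewrite E.
case: (ltnP (lam m) (size (rees_val p))) => h.
  rewrite (bigD1 (Ordinal h)) //= eqxx big1 ?addr0 // => n.
  by rewrite -val_eqE /= eq_sym => /negbTE ->.
rewrite [in RHS]nth_default // linear0 mcoeff0 big1 // => n _.
by rewrite gtn_eqF //; apply: leq_trans h.
Qed.

Lemma initial_form_toric p : initial_form p \in toric_pred Gam.
Proof.
apply/toric_predP => // m; rewrite mcoeff_msupp mcoeff_initial_form -mcoeff_msupp.
exact: N_supp.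
Qed.

Lemma initial_formB p q : initial_form (p - q) = initial_form p - initial_form q.
Proof.
by apply/mpolyP => m; rewrite mcoeffB !mcoeff_initial_form rees_valB coefB linearB mcoeffB.
Qed.

Lemma initial_form1 : initial_form 1 = 1.
Proof.
apply/mpolyP => m; rewrite mcoeff_initial_form rees_val1 coef1 mcoeff1.
have [->|m0] := eqVneq m 0%MM; first by rewrite lam0 eqxx coord1 mcoeffX eqxx.
case: (lam m == _); last by rewrite linear0 mcoeff0.
by rewrite coord1 mcoeffX eq_sym (negbTE m0).
Qed.

Lemma initial_formM p q : initial_form (p * q) = initial_form p * initial_form q.
Proof.
apply/mpolyP => m; rewrite mcoeff_initial_form rees_valM coefM linear_sum raddf_sum /=.
under eq_bigr => i _.
  rewrite (coordM_top (i := i) (j := lam m - i)); first last.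
  - by rewrite subnKC // -ltnS.
  - by move=> k; apply: rees_coef.
  - by move=> k; apply: rees_coef.
  rewrite mcoeffM; over.
rewrite exchange_big /= mcoeffM; apply: eq_bigr => -[a b] /= /eqP mE.
rewrite !mcoeff_initial_form.
have mab : lam m = (lam a + lam b)%N by rewrite -lamD -mE.
have am : (lam a < (lam m).+1)%N by lia.
(* The coefficient at [a] vanishes in degrees below lam a and the one at [b] in degrees below lam b,
   so only the splitting i = lam a of lam m survives. *)
rewrite (bigD1 (Ordinal am)) //= big1 ?addr0 => [|i ia].
  by congr (_ * (N _`_ _)@_ _); rewrite /= mab addKn.
have {}ia : i != lam a :> nat by [].
have [ai|ai] := ltnP i (lam a); first by rewrite rees_coef0 // mul0r.
by rewrite [X in _ * X]rees_coef0 ?mulr0 //; have := ltn_ord i; lia.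
Qed.

Lemma initial_formC (c : F) p : initial_form (c%:P *: p) = c *: initial_form p.
Proof.
apply/mpolyP => m; rewrite mcoeffZ !mcoeff_initial_form rees_valZ.
by rewrite map_polyC /= mul_polyC coefZ mulr_algl linearZ mcoeffZ.
Qed.

(** A vanishing initial form lowers the t^n coefficient to level n - 1, and to 0 for n = 0; division
    by t then stays in the Rees algebra. *)
Lemma initial_form_eq0 p : initial_form p = 0 <-> exists q : S, p = 'X *: q.
Proof.
split=> [p0|[q ->]]; last first.
  apply/mpolyP => m; rewrite mcoeff_initial_form coef_rees_scaleX mcoeff0.
  by case E: (lam m) => [|n]; [rewrite linear0 mcoeff0 | rewrite rees_coef0 ?E].
have lt_lam n m : m \in msupp (N (rees_val p)`_n) -> (lam m < n)%N.
  move=> mn; rewrite ltn_neqAle (rees_coef mn) andbT; apply: contraL mn => /eqP <-.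
  by rewrite -mcoeff_eq0 -mcoeff_initial_form p0 mcoeff0.
have q_mem : drop_poly 1 (rees_val p) \in rees_pred G.
  apply/rees_predP => n; rewrite coef_drop_poly addn1; apply/flP => m /lt_lam.
  by rewrite ltnS.
exists (MkRees q_mem); apply: val_inj; apply/polyP => n /=.
rewrite map_polyX coefXM; case: n => [|n] /=; last by rewrite coef_drop_poly addn1.
apply: N_inj; rewrite linear0; apply/eqP; rewrite -msupp_eq0.
by case: (msupp _) (lt_lam 0%N) => // m s /(_ m (mem_head _ _)).
Qed.

Lemma initial_form_surj f :
  f \in toric_pred Gam -> exists p, initial_form p = f.
Proof.
move=> /toric_predP fG; pose s := \sum_(m <- msupp f) (f@_m *: e m) *: 'X^(lam m) : {poly R}.
have sE n : N s`_n = \sum_(m <- msupp f | lam m == n) f@_m *: 'X_[m].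
  rewrite coef_sum linear_sum [RHS]big_mkcond /= !big_seq; apply: eq_bigr => m mf.
  rewrite coefZ coefXn eq_sym; case: eqP => _; last by rewrite mulr0 linear0.
  by rewrite mulr1 linearZ /= N_e //; apply: fG.
have sP : s \in rees_pred G.
  apply/rees_predP => n; apply/flP => m; rewrite sE -big_filter mcoeff_msupp.
  rewrite mcoeff_sum_monomials ?filter_uniq ?msupp_uniq // mem_filter.
  by case: (eqVneq (lam m) n) => [->//|_]; rewrite eqxx.
exists (MkRees sP); apply/mpolyP => m; rewrite mcoeff_initial_form /= sE -big_filter.
rewrite mcoeff_sum_monomials ?filter_uniq ?msupp_uniq // mem_filter eqxx /=.
by case: ifPn => // h; apply/esym/eqP; rewrite mcoeff_eq0.
Qed.

Lemma rees_special_fibre : special_fibre S (toric_alg F Gam).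
Proof.
pose g p : toric_alg F Gam := ToricAlg (initial_form_toric p).
have g_zmod : zmod_morphism g.
  by move=> p q; apply: val_inj; rewrite rmorphB /= initial_formB.
have g_mon : monoid_morphism g.
  split=> [|p q]; apply: val_inj; first by rewrite rmorph1 /= initial_form1.
  by rewrite rmorphM /= initial_formM.
pose gz := GRing.isZmodMorphism.Build _ _ g g_zmod.
pose gm := GRing.isMonoidMorphism.Build _ _ g g_mon.
pose gR := HB.pack_for {rmorphism S -> toric_alg F Gam} g gz gm.
have g0 p : g p = 0 <-> exists q : S, p = 'X *: q.
  rewrite -initial_form_eq0; split=> [/(congr1 val)|p0]; first by rewrite rmorph0.
  by apply: val_inj; rewrite rmorph0.
pose J0 : {pred S} := fun p => `[< exists q : S, p = 'X *: q >].
have [||J JE] := @is_ideal_idealr S J0.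
- split=> [|a p q /asboolP[p' ->] /asboolP[q' ->]]; apply/asboolP.
    by exists 0; rewrite scaler0.
  by exists (a * p' + q'); rewrite scalerDr scalerAr.
- apply/negP => /asboolP/g0/eqP; apply/negP.
  by rewrite -[g 1]/(gR 1) rmorph1 oner_neq0.
have JP p : p \in J <-> exists q : S, p = 'X *: q.
  by rewrite JE; split=> /asboolP.
exists J; split=> //.
have [||f [f_bij fE]] := @quot_alg_lift _ _ J _ gR.
- by move=> p; rewrite JP -g0.
- move=> [y yG]; have [p pE] := initial_form_surj yG.
  by exists p; apply: val_inj.
exists f; split=> // c u; rewrite -[u]reprK quot_alg_piZ !fE.
by apply: val_inj; rewrite /= initial_formC.
Qed.

Lemma coord_flat_deformation : flat_deformation R (toric_alg F Gam).
Proof.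
exists S; split; [exact: rees_flat | exact: rees_special_fibre |].
apply: rees_general_fibre => x; exists (\max_(m <- msupp (N x)) lam m)%N.
apply/flP => m mx; rewrite (big_rem m) //=; exact: leq_maxl.
Qed.

End Degeneration.

(** * The toric ideal *)

Lemma mpoly_linear_extension (F : fieldType) (n : nat) (V : lmodType F)
    (v : 'X_{1..n} -> V) :
  exists h : {linear {mpoly F[n]} -> V}, forall m, h 'X_[m] = v m.
Proof.
pose h (q : {mpoly F[n]}) := \sum_(m <- msupp q) q@_m *: v m.
have hE (q : {mpoly F[n]}) l : uniq l -> {subset msupp q <= l} ->
    h q = \sum_(m <- l) q@_m *: v m.
  move=> l_uniq sub; rewrite (bigID (mem (msupp q))) /= [X in _ + X]big1 ?addr0.
    rewrite -big_filter; apply: perm_big; apply: uniq_perm.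
    - exact: msupp_uniq.
    - exact: filter_uniq.
    - by move=> m; rewrite mem_filter; case: (boolP (m \in msupp q)) => // /sub.
  by move=> m /memN_msupp_eq0 ->; rewrite scale0r.
have h_lin : linear h.
  move=> c p q; pose l := undup (msupp p ++ msupp q).
  rewrite !(hE _ l) ?undup_uniq //.
  - rewrite scaler_sumr -big_split /=; apply: eq_bigr => m _.
    by rewrite mcoeffD mcoeffZ scalerDl scalerA.
  - by move=> m mq; rewrite mem_undup mem_cat mq orbT.
  - by move=> m mp; rewrite mem_undup mem_cat mp.
  - move=> m /msuppD_le; rewrite mem_undup !mem_cat => /orP[/msuppZ_le->//|->].
    by rewrite orbT.
exists (HB.pack_for {linear {mpoly F[n]} -> V} h (GRing.isLinear.Build _ _ _ _ h h_lin)).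
by move=> m; rewrite /= /h msuppX big_seq1 mcoeffX eqxx scale1r.
Qed.

Section IdealGen.
Variables (A : comNzRingType) (E : A -> Prop).

Lemma ideal_gen0 : ideal_gen E 0.
Proof. by exists 0%N, (fun=> 0), (fun=> 0); split=> [[]|] //; rewrite big_ord0. Qed.

Lemma ideal_gen_mem x : E x -> ideal_gen E x.
Proof.
by move=> Ex; exists 1%N, (fun=> 1), (fun=> x); rewrite big_ord1 mul1r.
Qed.

Lemma ideal_genMD a x y :
  ideal_gen E x -> ideal_gen E y -> ideal_gen E (a * x + y).
Proof.
move=> [n [c [g [gE ->]]]] [n' [c' [g' [gE' ->]]]].
exists (n + n')%N, (fun i => match split i with inl j => a * c j | inr j => c' j end),
  (fun i => match split i with inl j => g j | inr j => g' j end).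
split=> [i|]; first by case: (split i).
rewrite big_split_ord /= mulr_sumr; congr (_ + _); apply: eq_bigr => i _.
  by rewrite -[lshift _ _]/(unsplit (inl i)) unsplitK mulrA.
by rewrite -[rshift _ _]/(unsplit (inr i)) unsplitK.
Qed.

Lemma ideal_genM a x : ideal_gen E x -> ideal_gen E (a * x).
Proof. by move=> Ex; rewrite -[_ * _]addr0; apply: ideal_genMD ideal_gen0. Qed.

End IdealGen.

Section Toric.
Variables (F : fieldType) (r s : nat) (M : 'M[nat]_(r, s)).
Local Notation wt := (weight M).
Local Notation Gam := (col_semigroup M).

Lemma weightD a b : wt (a + b)%MM = (wt a + wt b)%MM.
Proof.
apply/mnmP => i; rewrite mnmDE !mnmE -big_split /=.
by apply: eq_bigr => j _; rewrite mnmDE mulnDr.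
Qed.

Lemma weight0 : wt 0%MM = 0%MM.
Proof.
by apply/mnmP => i; rewrite mnmE mnm0E big1 // => j _; rewrite mnm0E muln0.
Qed.

Lemma weight_expand a : wt a = (\sum_j wt U_(j) *+ a j)%MM.
Proof.
apply/mnmP => i; rewrite mnm_sumE mnmE; apply: eq_bigr => j _.
rewrite mulmnE mnmE (bigD1 j) //= mnm1E eqxx muln1 big1 ?addn0 // => k kj.
by rewrite mnm1E eq_sym (negbTE kj) muln0.
Qed.

Lemma col_semigroup0 : Gam 0%MM.
Proof. by exists 0%MM; rewrite weight0. Qed.

Lemma col_semigroupD a b : Gam a -> Gam b -> Gam (a + b)%MM.
Proof. by move=> [a' ->] [b' ->]; exists (a' + b')%MM; rewrite weightD. Qed.

(** The monomial map that sends X_j to T to the power of the j-th column of [M]; its kernel is the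
    toric ideal. *)
Definition weight_map : {mpoly F[s]} -> {mpoly F[r]} :=
  mmap (@mpolyC r F) (fun j => 'X_[wt U_(j)]).

Lemma weight_mapX a : weight_map 'X_[a] = 'X_[wt a].
Proof. by rewrite /weight_map mmapX /mmap1 mprodXnE -weight_expand. Qed.

Lemma weight_map_linear : linear weight_map.
Proof. by move=> c p q; rewrite /weight_map mmapD mmapZ mul_mpolyC. Qed.

Lemma weight_map_toric p : weight_map p \in toric_pred Gam.
Proof.
have [T1 TL TM] := @toric_closed F r Gam.
have T0 : 0 \in toric_pred (F := F) Gam.
  by have := TL (-1) _ _ T1 T1; rewrite scaleN1r addNr.
elim/mpolyind: p => [|c m p _ _ IH]; first by rewrite /weight_map mmap0.
rewrite weight_map_linear; apply: TL => //; rewrite weight_mapX.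
by apply/asboolP => P _; apply; exists m.
Qed.

Lemma toric_quotient :
  exists J : idealr {mpoly F[s]},
    (forall f, f \in J <-> toric_ideal M f) /\
    alg_iso (quot_alg J) (toric_alg F Gam).
Proof.
have wm_zmod : zmod_morphism weight_map by move=> p q; rewrite /weight_map mmapB.
have wm_mon : monoid_morphism weight_map by split=> [|p q]; rewrite /weight_map ?rmorph1 ?rmorphM.
pose g p : toric_alg F Gam := ToricAlg (weight_map_toric p).
have g_zmod : zmod_morphism g.
  by move=> p q; apply: val_inj; rewrite rmorphB /= wm_zmod.
have g_mon : monoid_morphism g.
  split=> [|p q]; apply: val_inj; first by rewrite rmorph1 /= wm_mon.1.
  by rewrite rmorphM /= wm_mon.2.
have g_scal : scalable g.
  move=> c p; apply: val_inj; rewrite linearZ /=.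
  by rewrite /weight_map mmapZ mul_mpolyC.
pose gz := GRing.isZmodMorphism.Build _ _ g g_zmod.
pose gm := GRing.isMonoidMorphism.Build _ _ g g_mon.
pose gs := GRing.isScalable.Build F _ _ *:%R g g_scal.
pose gR := HB.pack_for {lrmorphism {mpoly F[s]} -> toric_alg F Gam} g gz gm gs.
have ex_rep k : exists a, Gam k -> k = wt a.
  by have [[a ->]|nG] := pselect (Gam k); [exists a | exists 0%MM].
have [rep repP] := choice ex_rep.
have [th thX] := mpoly_linear_extension (fun k => 'X_[rep k] : {mpoly F[s]}).
(* Modulo the binomials, X^a depends only on its weight. Hence p is congruent to the polynomial
   rebuilt from [weight_map p] with one representative per weight, and the kernel lies in the toric
   ideal. *)
have congr_rep p : toric_ideal M (p - th (weight_map p)).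
  elim/mpolyind: p => [|c m p _ _ IH].
    by rewrite /weight_map mmap0 linear0 subrr; apply: ideal_gen0.
  rewrite weight_map_linear linearP opprD addrACA -scalerBr -mul_mpolyC.
  apply: ideal_genMD IH; apply: ideal_gen_mem.
  exists m, (rep (wt m)); rewrite weight_mapX thX -repP //.
  by exists m.
have kerP p : toric_ideal M p <-> g p = 0.
  split=> [[n [c [f [fE ->]]]]|/(congr1 val)].
    rewrite -[g _]/(gR _) raddf_sum big1 // => i _; rewrite [LHS](g_mon.2 (c i) (f i)).
    have [a [b [ab ->]]] := fE i; suff -> : g ('X_[a] - 'X_[b]) = 0 by rewrite mulr0.
    by apply: val_inj; rewrite rmorph0 /= wm_zmod !weight_mapX ab subrr.
  rewrite rmorph0 /= => p0; have := congr_rep p.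
  by rewrite p0 linear0 subr0.
have [||J JE] := @is_ideal_idealr {mpoly F[s]} (fun p => `[< toric_ideal M p >]).
- split=> [|a p q /asboolP hp /asboolP hq]; apply/asboolP; first exact: ideal_gen0.
  exact: ideal_genMD.
- apply/negP => /asboolP/kerP; rewrite -[g 1]/(gR 1) rmorph1 => /eqP.
  by rewrite oner_eq0.
have JP p : p \in J <-> toric_ideal M p by rewrite JE; split=> /asboolP.
exists J; split=> //; apply: (@quot_alg_iso _ _ _ _ gR) => [p|[y yG]].
  by rewrite JP kerP.
have /toric_predP yG' := yG.
exists (th y); apply: val_inj => /=.
rewrite [in LHS](mpolyE y) linear_sum -[weight_map _]/(val (gR _)) !raddf_sum /=.
rewrite [RHS]mpolyE big_seq [RHS]big_seq; apply: eq_bigr => m ym.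
rewrite linearZ thX /weight_map mmapZ mul_mpolyC -/(weight_map _) weight_mapX -repP //.
by apply: yG' => //; [exact: col_semigroup0 | exact: col_semigroupD].
Qed.

End Toric.

(** * Order functions *)

Section MonomialOrder.
Variables (n : nat) (lt : rel 'X_{1..n}).
Hypothesis mo : monomial_order lt.

Lemma olt_irr : irreflexive (olt lt).
Proof. by case=> //= a; apply: mo_irr. Qed.

Lemma olt_trans : transitive (olt lt).
Proof. by move=> [b|] [a|] [c|] //=; apply: (mo_trans mo). Qed.

Lemma olt_total x y : x != y -> olt lt x y || olt lt y x.
Proof.
case: x y => [a|] [b|] //= ab; apply: (mo_total mo).
by apply: contra ab => /eqP->.
Qed.

Lemma ole_lt_trans y x z : ole lt x y -> olt lt y z -> olt lt x z.
Proof. by case/orP => [/eqP->//|xy yz]; apply: olt_trans xy yz. Qed.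

Lemma ole_maxl x y : ole lt x (omax lt x y).
Proof.
by rewrite /omax; case: ifP => [xy|_]; rewrite /ole ?xy ?eqxx ?orbT.
Qed.

Lemma ole_maxr x y : ole lt y (omax lt x y).
Proof.
rewrite /omax /ole; case: ifPn => [_|xy]; first by rewrite eqxx.
case: (eqVneq y x) => //= yx; have := olt_total yx.
by rewrite (negbTE xy) orbF.
Qed.

Lemma omax_lt x y z : olt lt x z -> olt lt y z -> olt lt (omax lt x y) z.
Proof. by rewrite /omax; case: ifP. Qed.

Lemma oadd_ltr (x y y' : option 'X_{1..n}) :
  x != None -> olt lt y y' -> olt lt (oadd x y) (oadd x y').
Proof.
case: x y y' => [a|] [b|] [b'|] //= _ bb'.
by rewrite ![(a + _)%MM]addmC (mo_add mo).
Qed.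

Lemma oaddC (x y : option 'X_{1..n}) : oadd x y = oadd y x.
Proof. by case: x y => [a|] [b|] //=; rewrite addmC. Qed.

Lemma oadd_ltl (x y y' : option 'X_{1..n}) :
  x != None -> olt lt y y' -> olt lt (oadd y x) (oadd y' x).
Proof. by rewrite ![oadd (n := n) _ x]oaddC; apply: oadd_ltr. Qed.

Lemma mo_add2 a b c d : lt a b -> (c = d \/ lt c d) -> lt (a + c)%MM (b + d)%MM.
Proof.
move=> ab [->|cd]; first exact: mo_add mo _ _ _ ab.
apply: (mo_trans mo) (mo_add mo c ab) _.
by rewrite ![(b + _)%MM]addmC (mo_add mo).
Qed.

Variable F : fieldType.
Implicit Types q : {mpoly F[n]}.

Lemma lead_monomial_unique q a b :
  is_lead_monomial lt q a -> is_lead_monomial lt q b -> a = b.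
Proof.
move=> [aq ha] [bq hb]; apply/eqP/negPn/negP => ab.
have := mo_trans mo (hb _ aq ab) (ha _ bq _); rewrite eq_sym ab => /(_ isT).
by rewrite (mo_irr mo).
Qed.

Lemma lead_monomial_exists q : q != 0 -> exists a, is_lead_monomial lt q a.
Proof.
rewrite -msupp_eq0 /is_lead_monomial; elim: (msupp q) => // b l IH _.
have [->|/IH[a [al ha]]] := eqVneq l [::].
  by exists b; split=> [|c]; rewrite inE // => /eqP-> /eqP.
have [ab|ab] := eqVneq b a.
  exists a; split=> [|c]; first by rewrite inE al orbT.
  by rewrite inE ab => /orP[/eqP->|/ha//]; rewrite eqxx.
have /orP[ltba|ltab] := mo_total mo ab.
  exists a; split=> [|c]; first by rewrite inE al orbT.
  by rewrite inE => /orP[/eqP->|/ha//].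
exists b; split=> [|c]; first by rewrite mem_head.
rewrite inE => /orP[/eqP->|cl]; first by rewrite eqxx.
move=> _; have [->//|/(ha _ cl) ca] := eqVneq c a.
exact: (mo_trans mo) ca ltab.
Qed.

Lemma lead_monomial_bound q a b :
  is_lead_monomial lt q a -> b \in msupp q -> b = a \/ lt b a.
Proof. by move=> [_ ha] /ha h; case: (eqVneq b a) => [->|/h]; [left|right]. Qed.

End MonomialOrder.

Section CoordinateOrder.
Variables (F : fieldType) (r : nat) (lt : rel 'X_{1..r}).
Hypothesis mo : monomial_order lt.
Variables (Gam : 'X_{1..r} -> Prop) (R : comAlgType F) (e : 'X_{1..r} -> R).
Variable (N : {linear R -> {mpoly F[r]}}).
Hypothesis N_inj : injective N.
Hypothesis N_supp : forall x m, m \in msupp (N x) -> Gam m.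
Hypothesis N_e : forall m, Gam m -> N (e m) = 'X_[m].
Hypothesis N_M : forall a b, Gam a -> Gam b ->
  is_lead_monomial lt (N (e a * e b)) (a + b)%MM.

Lemma coord_sum x : x = \sum_(m <- msupp (N x)) (N x)@_m *: e m.
Proof.
apply: N_inj; rewrite linear_sum [LHS]mpolyE big_seq [RHS]big_seq.
by apply: eq_bigr => m /N_supp Gm; rewrite linearZ /= N_e.
Qed.

Lemma coordM x y : N (x * y) = \sum_(a <- msupp (N x)) \sum_(b <- msupp (N y))
  ((N x)@_a * (N y)@_b) *: N (e a * e b).
Proof.
rewrite {1}[x]coord_sum {1}[y]coord_sum mulr_suml linear_sum; apply: eq_bigr => a _.
rewrite mulr_sumr linear_sum; apply: eq_bigr => b _.
by rewrite -scalerAl -scalerAr scalerA linearZ.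
Qed.

(** Only the pair (a, b) of basis elements produces the exponent a + b; all other exponents that
    occur are strictly below it, so nothing cancels there. *)
Lemma coordM_lead x y a b :
  is_lead_monomial lt (N x) a -> is_lead_monomial lt (N y) b ->
  is_lead_monomial lt (N (x * y)) (a + b)%MM.
Proof.
move=> lx ly.
have term k l m : k \in msupp (N x) -> l \in msupp (N y) ->
    m \in msupp (N (e k * e l)) -> (k, l, m) = (a, b, (a + b)%MM) \/ lt m (a + b)%MM.
  move=> kx lyy mkl; have Gk := N_supp kx; have Gl := N_supp lyy.
  have kl : (k, l) = (a, b) \/ lt (k + l)%MM (a + b)%MM.
    have [->|ka] := lead_monomial_bound lx kx; last first.
      right; apply: (mo_add2 mo) => //; exact: lead_monomial_bound ly lyy.
    have [->|lb] := lead_monomial_bound ly lyy; first by left.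
    by right; rewrite ![(a + _)%MM]addmC; apply: (mo_add mo).
  have [mE|mlt] := lead_monomial_bound (N_M Gk Gl) mkl.
    by case: kl => [[ka lb]|kl]; [left; rewrite mE ka lb|right; rewrite mE].
  by right; case: kl => [[<- <-]//|]; apply: (mo_trans mo).
have [ax _] := lx; have [by_ _] := ly.
have other k l : k \in msupp (N x) -> l \in msupp (N y) -> (k, l) <> (a, b) ->
    (N (e k * e l))@_(a + b)%MM = 0.
  move=> kx lyy kl; apply/eqP; rewrite mcoeff_eq0; apply/negP.
  by case/(term _ _ _ kx lyy) => [[ka lb]|]; [case: kl; rewrite ka lb|rewrite (mo_irr mo)].
split=> [|m].
  rewrite mcoeff_msupp coordM raddf_sum (bigD1_seq a) ?msupp_uniq //=.
  rewrite raddf_sum (bigD1_seq b) ?msupp_uniq //= big1_seq ?addr0 => [|l /andP[lb lyy]].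
    rewrite big1_seq ?addr0 => [|k /andP[ka kx]].
      rewrite mcoeffZ !mulf_neq0 -?mcoeff_msupp //.
      by have [] := N_M (N_supp ax) (N_supp by_).
    rewrite raddf_sum big1_seq // => l /andP[_ lyy].
    by rewrite /= mcoeffZ other ?mulr0 // => -[ka' _]; rewrite ka' eqxx in ka.
  by rewrite /= mcoeffZ other ?mulr0 // => -[lb']; rewrite lb' eqxx in lb.
rewrite coordM => /msupp_sum_le/flatten_mapP[k]; rewrite filter_predT => kx.
move=> /msupp_sum_le/flatten_mapP[l]; rewrite filter_predT => lyy.
by move=> /msuppZ_le/(term _ _ _ kx lyy)[[_ _ ->]|//]; rewrite eqxx.
Qed.

(** The value of x is the leading monomial of [N x]. Products are handled by [coordM_lead], and for
    equal values the quotient of the leading coefficients is the scalar that cancels the leading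
    terms. *)
Lemma coord_order_function :
  exists rho : R -> option 'X_{1..r}, order_function lt Gam rho.
Proof.
have ex_rho x : exists o, if o is Some a then is_lead_monomial lt (N x) a else x = 0.
  have [->|x0] := eqVneq x 0; first by exists None.
  have [|a la] := lead_monomial_exists mo (q := N x); last by exists (Some a).
  by apply: contra x0 => /eqP Nx0; apply/eqP/N_inj; rewrite linear0.
have [rho rhoP] := choice ex_rho.
have rhoE x a : is_lead_monomial lt (N x) a -> rho x = Some a.
  move=> la; have := rhoP x; case: (rho x) => [b lb|x0].
    by rewrite (lead_monomial_unique mo la lb).
  by case: la; rewrite x0 linear0 msupp0.
have rho_supp x a : rho x = Some a -> is_lead_monomial lt (N x) a.
  by move=> xa; have := rhoP x; rewrite xa.
have rho0 x : rho x = None <-> x = 0.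
  split=> [xN|x0]; first by have := rhoP x; rewrite xN.
  case E : (rho x) => [a|] //; have [] := rho_supp _ _ E.
  by rewrite x0 linear0 msupp0.
have rho_le x m : m \in msupp (N x) -> ole lt (Some m) (rho x).
  move=> mx; case E : (rho x) => [a|]; last first.
    by move/rho0: E => x0; rewrite x0 linear0 msupp0 in mx.
  rewrite /ole /=; have [->|->] := lead_monomial_bound (rho_supp _ _ E) mx.
    by rewrite eqxx.
  by rewrite orbT.
have ole_trans x y z : ole lt x y -> ole lt y z -> ole lt x z.
  move=> xy /orP[/eqP<-//|yz]; rewrite /ole; apply/orP; right.
  exact: (ole_lt_trans mo xy yz).
exists rho; split=> //.
- by move=> f a /rho_supp[/N_supp].
- move=> a Ga; exists (e a); apply: rhoE; rewrite N_e //.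
  by split=> [|b]; rewrite msuppX inE // => ->.
- move=> f c c0; have [->|f0] := eqVneq f 0; first by rewrite scaler0.
  case E : (rho f) => [a|]; last by move/rho0: E f0 => ->; rewrite eqxx.
  have [af ha] := rho_supp _ _ E; apply: rhoE; rewrite linearZ /=; split=> [|b].
    by rewrite mcoeff_msupp mcoeffZ mulf_neq0 // -mcoeff_msupp.
  by move=> /msuppZ_le; apply: ha.
- move=> f g; case E : (rho (f + g)) => [a|]; last first.
    by rewrite /ole; case: (omax _ _ _).
  have [+ _] := rho_supp _ _ E; rewrite linearD => /msuppD_le.
  rewrite mem_cat => /orP[] /rho_le h; apply: ole_trans h _.
    exact: ole_maxl.
  exact: ole_maxr.
- move=> f g fg f0; case E : (rho f) f0 => [a|] // _.
  have lf := rho_supp _ _ E; have lg : is_lead_monomial lt (N g) a.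
    by apply: rho_supp; rewrite -fg.
  have [af _] := lf; have [ag _] := lg.
  exists ((N f)@_a / (N g)@_a); split.
    by rewrite mulf_neq0 ?invr_eq0 -?mcoeff_msupp.
  case E' : (rho (f - _)) => [b|] //=; have [bE _] := rho_supp _ _ E'.
  move: bE; rewrite linearB linearZ /= => bE.
  have ba : b != a.
    apply: contraL bE => /eqP->; rewrite -mcoeff_eq0 mcoeffB mcoeffZ.
    by rewrite divfK ?subrr // -mcoeff_msupp.
  have := msuppB_le bE; rewrite mem_cat => /orP[bf|/msuppZ_le bg].
    by have [_ ->] := lf.
  by have [_ ->] := lg.
- move=> f g; case Ef : (rho f) => [a|]; last first.
    by move/rho0: Ef => ->; rewrite mul0r; apply/rho0.
  case Eg : (rho g) => [b|]; last first.
    by move/rho0: Eg => ->; rewrite mulr0; apply/rho0.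
  by apply: rhoE; apply: coordM_lead; apply: rho_supp.
Qed.

End CoordinateOrder.

(** * Leading-term calculus for an order function *)

Section OrderFunctionTheory.
Variables (F : fieldType) (r : nat) (lt : rel 'X_{1..r}).
Hypothesis mo : monomial_order lt.
Variables (Gam : 'X_{1..r} -> Prop) (R : comAlgType F).
Variable rho : R -> option 'X_{1..r}.
Hypothesis hrho : order_function lt Gam rho.
Implicit Types x y z : R.

Lemma rho0 : rho 0 = None.
Proof. exact/(of_0 hrho). Qed.

Lemma rho_neq0 x : x != 0 -> rho x != None.
Proof. by move=> x0; apply: contra x0 => /eqP/(of_0 hrho)->. Qed.

Lemma rhoZ c x : c != 0 -> rho (c *: x) = rho x.
Proof. exact: (of_scale hrho). Qed.

Lemma rhoM x y : rho (x * y) = oadd (rho x) (rho y).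
Proof. exact: (of_mul hrho). Qed.

Lemma rho1 : rho 1 = Some 0%MM.
Proof.
have := rhoM 1 1; rewrite mulr1; case E : (rho 1) => [a|] /=; last first.
  by have := rho_neq0 (oner_neq0 R); rewrite E.
by move=> [aa]; congr Some; apply: (@addmI _ a); rewrite addm0.
Qed.

Lemma rhoD_lt x y o : olt lt (rho x) o -> olt lt (rho y) o -> olt lt (rho (x + y)) o.
Proof.
by move=> xo yo; apply: (ole_lt_trans mo (of_add hrho _ _)); apply: omax_lt.
Qed.

Lemma rhoZ_lt c x o : olt lt (rho x) o -> olt lt (rho (c *: x)) o.
Proof.
have [->|c0] := eqVneq c 0; last by rewrite rhoZ.
by rewrite scale0r rho0; case: o => //; case: (rho x).
Qed.

Lemma rhoB_lt x y o : olt lt (rho x) o -> olt lt (rho y) o -> olt lt (rho (x - y)) o.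
Proof. by move=> xo yo; rewrite -scaleN1r; apply/rhoD_lt/rhoZ_lt. Qed.

Lemma rho_sum_lt (I : eqType) (l : seq I) (f : I -> R) a :
  (forall i, i \in l -> olt lt (rho (f i)) (Some a)) ->
  olt lt (rho (\sum_(i <- l) f i)) (Some a).
Proof.
move=> fa; rewrite big_seq; elim/big_rec: _ => [|i x /fa fi xa]; first by rewrite rho0.
exact: rhoD_lt.
Qed.

(** A larger value contradicts the ultrametric inequality, and a smaller one contradicts it for x =
    (x + y) - y. *)
Lemma rhoDl x y : olt lt (rho y) (rho x) -> rho (x + y) = rho x.
Proof.
move=> yx; apply/eqP/negPn/negP => /(olt_total mo)/orP[h|h].
  have := rhoB_lt h yx; rewrite addrK.
  by rewrite (olt_irr mo).
have := of_add hrho x y; rewrite /omax; case: ifP => [xy|_].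
  by have := olt_trans mo xy yx; rewrite (olt_irr mo).
case/orP => [/eqP e|h']; first by rewrite e (olt_irr mo) in h.
by have := olt_trans mo h h'; rewrite (olt_irr mo).
Qed.

(** For nonzero [c], x and c y have the same leading term: [c] stands for the quotient of their
    leading coefficients. *)
Definition same_lead x y c := olt lt (rho (x - c *: y)) (rho y).

Lemma same_lead_exists x y :
  rho x = rho y -> y != 0 -> exists2 c, c != 0 & same_lead x y c.
Proof.
move=> xy y0; have [|c [c0 h]] := of_sub hrho xy; last first.
  by exists c => //; rewrite /same_lead -xy.
by rewrite xy; apply/eqP/rho_neq0.
Qed.

(** Two different scalars would give (c - d) y a value below that of y. *)
Lemma same_lead_unique x y c d : same_lead x y c -> same_lead x y d -> c = d.
Proof.
move=> xc xd; apply/eqP/negPn/negP => cd.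
have := rhoB_lt xd xc; rewrite opprB addrC addrA subrK -scalerBl rhoZ.
  by rewrite (olt_irr mo).
by rewrite subr_eq0.
Qed.

Lemma same_lead_refl x : x != 0 -> same_lead x x 1.
Proof.
move=> x0; rewrite /same_lead scale1r subrr rho0.
by case: (rho x) (rho_neq0 x0).
Qed.

Lemma same_lead_rho x y c : c != 0 -> same_lead x y c -> rho x = rho y.
Proof.
move=> c0 h; rewrite -[x](subrK (c *: y)) addrC rhoDl rhoZ //.
Qed.

Lemma same_lead_sym x y c : c != 0 -> same_lead x y c -> same_lead y x c^-1.
Proof.
move=> c0 h; rewrite /same_lead (same_lead_rho c0 h).
have -> : y - c^-1 *: x = - c^-1 *: (x - c *: y).
  by rewrite scalerBr scaleNr scalerA mulNr mulVf // scaleN1r opprK addrC.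
by rewrite rhoZ ?oppr_eq0 ?invr_eq0.
Qed.

Lemma same_leadM x y c x' y' d : y != 0 -> y' != 0 -> c != 0 -> d != 0 ->
  same_lead x y c -> same_lead x' y' d -> same_lead (x * x') (y * y') (c * d).
Proof.
move=> y0 y'0 c0 d0 xy xy'; rewrite /same_lead.
have -> : x * x' - (c * d) *: (y * y') = (x - c *: y) * x' + c *: y * (x' - d *: y').
  by rewrite -scalerA mulrBl mulrBr -!scalerAl -scalerAr addrA subrK.
rewrite rhoM; apply: rhoD_lt.
  by rewrite rhoM (same_lead_rho d0 xy') oadd_ltl // rho_neq0.
by rewrite rhoM rhoZ // oadd_ltr // rho_neq0.
Qed.

Lemma same_lead_prod (I : eqType) (l : seq I) (x y : I -> R) (c : I -> F) :
  (forall i, y i != 0) -> (forall i, c i != 0) ->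
  (forall i, same_lead (x i) (y i) (c i)) ->
  (\prod_(i <- l) y i != 0) /\
  same_lead (\prod_(i <- l) x i) (\prod_(i <- l) y i) (\prod_(i <- l) c i).
Proof.
move=> y0 c0 xy; elim: l => [|i l [p0 IH]].
  by rewrite !big_nil oner_neq0; split=> //; apply/same_lead_refl/oner_neq0.
rewrite !big_cons; split; last first.
  by apply: same_leadM => //; rewrite prodf_seq_neq0; apply/allP => j _; rewrite c0 implybT.
apply: contraTneq (rho_neq0 p0) => e.
have := rhoM (y i) (\prod_(j <- l) y j); rewrite e rho0.
by case: (rho (y i)) (rho_neq0 (y0 i)) => // a _; case: (rho _).
Qed.

Lemma same_lead_exp x y c k : y != 0 -> c != 0 ->
  same_lead x y c -> same_lead (x ^+ k) (y ^+ k) (c ^+ k).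
Proof.
move=> y0 c0 xy; have := same_lead_prod (index_iota 0 k) (fun=> y0) (fun=> c0) (fun=> xy).
by rewrite !prodr_const_nat subn0 => -[].
Qed.

End OrderFunctionTheory.

(** * Rescaling the generators by a character *)

Section Generators.
Variables (F : fieldType) (r s : nat) (lt : rel 'X_{1..r}) (M : 'M[nat]_(r, s)).
Hypothesis mo : monomial_order lt.
Variables (R : comAlgType F) (rho : R -> option 'X_{1..r}).
Hypothesis hrho : order_function lt (col_semigroup M) rho.
Local Notation wt := (weight M).

Lemma mmap1D (A : comNzRingType) (h : 'I_s -> A) a b :
  mmap1 h (a + b)%MM = mmap1 h a * mmap1 h b.
Proof.
by rewrite /mmap1 -big_split /=; apply: eq_bigr => i _; rewrite mnmDE exprD.
Qed.

Lemma mmap1Mn (A : comNzRingType) (h : 'I_s -> A) a k :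
  mmap1 h (a *+ k)%MM = mmap1 h a ^+ k.
Proof.
by rewrite /mmap1 -prodrXl; apply: eq_bigr => i _; rewrite mulmnE exprM.
Qed.

Lemma mmap1_sum (A : comNzRingType) (h : 'I_s -> A) (I : Type) (l : seq I) f :
  mmap1 h (\sum_(i <- l) f i)%MM = \prod_(i <- l) mmap1 h (f i).
Proof. by apply: (big_morph (mmap1 h)); [exact: mmap1D | exact: mmap11]. Qed.

Lemma rho_mmap1 (phi : 'I_s -> R) :
  (forall j, rho (phi j) = Some (wt U_(j)%MM)) ->
  forall a, rho (mmap1 phi a) = Some (wt a).
Proof.
move=> phiE a; rewrite weight_expand /mmap1.
elim: (index_enum _) => [|j l IH]; first by rewrite !big_nil (rho1 hrho).
rewrite !big_cons (rhoM hrho) IH.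
suff -> : rho (phi j ^+ a j) = Some (wt U_(j) *+ a j)%MM by [].
elim: (a j) => [|k IHk]; first by rewrite expr0 mulm0n (rho1 hrho).
by rewrite exprS (rhoM hrho) IHk phiE mulmS.
Qed.

(* The leading coefficients define a character of the lattice ker M, which    *)
(* extends to Z^s because ker M is a direct summand.                          *)
Lemma lead_character (phi : 'I_s -> R) :
  (forall j, rho (phi j) = Some (wt U_(j)%MM)) ->
  exists2 chi : 'I_s -> F, (forall j, chi j != 0) &
    forall a b, wt a = wt b ->
      same_lead lt rho (mmap1 phi a) (mmap1 phi b) (mmap1 chi a / mmap1 chi b).
Proof.
move=> phiE; have phiX := rho_mmap1 phiE.
have phi0 a : mmap1 phi a != 0.
  by apply/eqP => /(of_0 hrho); rewrite phiX.
have lead a b : wt a = wt b ->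
    exists2 c, c != 0 & same_lead lt rho (mmap1 phi a) (mmap1 phi b) c.
  by move=> ab; apply: (same_lead_exists hrho) => //; rewrite !phiX ab.
pose MZ : 'M[int]_(r, s) := \matrix_(i, j) (M i j)%:Z.
have [P [MP Pid]] := int_kernel_projection MZ.
(* Column [j] of the projection lies in ker M; its positive and negative parts have equal weight,
   and [chi j] will be the quotient of the leading coefficients of their monomials. *)
pose pos (j : 'I_s) : 'X_{1..s} := [multinom `|Num.max (P i j) 0|%N | i < s].
pose neg (j : 'I_s) : 'X_{1..s} := [multinom `|Num.max (- P i j) 0|%N | i < s].
have posneg i j : P i j = (pos j i)%:Z - (neg j i)%:Z by rewrite !mnmE; lia.
have wt_posneg j : wt (pos j) = wt (neg j).
  apply/mnmP => i; have := congr1 (fun A : 'M[int]_(r, s) => A i j) MP.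
  rewrite !mxE => h; rewrite [LHS]mnmE [RHS]mnmE; apply/eqP.
  rewrite -eqz_nat -subr_eq0 -!natz !natr_sum -sumrB; apply/eqP; rewrite -[RHS]h.
  by apply: eq_bigr => k _; rewrite mxE posneg !natrM !natz mulrBr.
have ex_chi j : exists c, c != 0 /\
    same_lead lt rho (mmap1 phi (pos j)) (mmap1 phi (neg j)) c.
  by have [c c0 hc] := lead _ _ (wt_posneg j); exists c.
have [chi chiP] := choice ex_chi.
exists chi => [j|a b ab]; first by have [] := chiP j.
(* A - B is the projection of a - b. As a - b lies in ker M, this is a - b itself, whence a + B = b
   + A. *)
pose A := (\sum_j (pos j *+ a j + neg j *+ b j))%MM.
pose B := (\sum_j (neg j *+ a j + pos j *+ b j))%MM.
have aB : (a + B = b + A)%MM.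
  pose x : 'cV[int]_s := \col_j ((a j)%:Z - (b j)%:Z).
  have Mx : MZ *m x = 0.
    apply/colP => i; have := congr1 (fun m : 'X_{1..r} => m i) ab.
    rewrite /= ![wt _ _]mnmE => h; rewrite !mxE; move/eqP: h.
    rewrite -eqz_nat -subr_eq0 -!natz !natr_sum -sumrB => /eqP h; rewrite -[RHS]h.
    by apply: eq_bigr => k _; rewrite !mxE !natrM !natz mulrBr.
  apply/mnmP => i; have := congr1 (fun A : 'cV[int]_s => A i 0) (Pid _ Mx).
  rewrite mxE [in RHS]mxE => h; rewrite !mnmDE !mnm_sumE.
  set nB := (\sum_j _)%N; set nA := (\sum_j _)%N.
  suff hAB : nA%:Z - nB%:Z = (a i)%:Z - (b i)%:Z by lia.
  rewrite -h /nA /nB -!natz !natr_sum -sumrB; apply: eq_bigr => j _.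
  by rewrite !mnmDE !mulmnE !natrD !natrM !natz mxE posneg; ring.
have AB : same_lead lt rho (mmap1 phi A) (mmap1 phi B) (mmap1 chi a / mmap1 chi b).
  have -> : mmap1 chi a / mmap1 chi b = \prod_j (chi j ^+ a j * (chi j)^-1 ^+ b j).
    rewrite big_split /= /mmap1; congr (_ * _); rewrite -prodfV.
    by apply: eq_bigr => j _; rewrite exprVn.
  rewrite /A /B !mmap1_sum; apply: (same_lead_prod mo hrho _ _ _ _).2 => j.
  - exact: phi0.
  - by rewrite mulf_neq0 // expf_neq0 ?invr_eq0 //; have [] := chiP j.
  - have [c0 hc] := chiP j; rewrite !mmap1D !mmap1Mn.
    apply: (same_leadM mo hrho); rewrite -?mmap1Mn ?phi0 ?expf_neq0 ?invr_eq0 //.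
      by rewrite !mmap1Mn; apply: (same_lead_exp mo hrho).
    rewrite !mmap1Mn; apply: (same_lead_exp mo hrho); rewrite ?invr_eq0 //.
    exact: (same_lead_sym mo hrho).
have [c c0 hc] := lead _ _ ab.
have chi0 a' : mmap1 chi a' != 0.
  by rewrite prodf_seq_neq0; apply/allP => j _; rewrite expf_neq0 //; have [] := chiP j.
suff <- : c = mmap1 chi a / mmap1 chi b by [].
have d0 : mmap1 chi a / mmap1 chi b != 0 by rewrite mulf_neq0 ?invr_eq0.
(* The monomials of a + B and b + B are compared twice: through a against b, which gives [c], and
   through A against B, which gives the character. *)
apply: (same_lead_unique mo hrho (x := mmap1 phi (a + B)%MM) (y := mmap1 phi (b + B)%MM)).
  rewrite !mmap1D -[c]mulr1; apply: (same_leadM mo hrho) => //; first exact: oner_neq0.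
  exact: (same_lead_refl hrho).
rewrite aB !mmap1D -[_ / _]mul1r; apply: (same_leadM mo hrho) => //; first exact: oner_neq0.
exact: (same_lead_refl hrho).
Qed.

(** Division of each generator by its character value turns every quotient of leading coefficients
    within one weight into 1. *)
Lemma normalised_generators :
  exists phi : 'I_s -> R,
    (forall a, rho (mmap1 phi a) = Some (wt a)) /\
    forall a b, wt a = wt b ->
      olt lt (rho (mmap1 phi a - mmap1 phi b)) (Some (wt b)).
Proof.
have ex_phi j : exists x, rho x = Some (wt U_(j)%MM).
  by apply: (of_surj hrho); exists U_(j)%MM.
have [phi phiE] := choice ex_phi.
have [chi chi0 chiP] := lead_character phiE.
pose psi j := (chi j)^-1 *: phi j.
have psiX a : mmap1 psi a = (mmap1 chi a)^-1 *: mmap1 phi a.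
  rewrite /mmap1 -prodfV -scaler_prod; apply: eq_bigr => j _.
  by rewrite /psi exprZn exprVn.
have chiX0 a : mmap1 chi a != 0.
  by rewrite prodf_seq_neq0; apply/allP => j _; rewrite expf_neq0.
exists psi; split=> [a|a b ab].
  by rewrite psiX (rhoZ hrho) ?invr_eq0 // (rho_mmap1 phiE).
have -> : mmap1 psi a - mmap1 psi b =
    (mmap1 chi a)^-1 *: (mmap1 phi a - (mmap1 chi a / mmap1 chi b) *: mmap1 phi b).
  by rewrite !psiX scalerBr scalerA mulrA mulVf // mul1r.
rewrite (rhoZ hrho) ?invr_eq0 // -(rho_mmap1 phiE); exact: chiP.
Qed.

End Generators.

(** * Bases adapted to an order function *)

Lemma coordinates_of_basis (F : fieldType) (r : nat) (Gam : 'X_{1..r} -> Prop)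
    (R : comAlgType F) (th : {linear {mpoly F[r]} -> R}) :
  (forall q, (forall m, m \in msupp q -> Gam m) -> th q = 0 -> q = 0) ->
  (forall x, exists q, (forall m, m \in msupp q -> Gam m) /\ th q = x) ->
  exists N : {linear R -> {mpoly F[r]}},
    [/\ injective N, forall x m, m \in msupp (N x) -> Gam m,
        cancel N th &
        forall q, (forall m, m \in msupp q -> Gam m) -> N (th q) = q].
Proof.
move=> th_inj0 ex_N; pose GS (q : {mpoly F[r]}) := forall m, m \in msupp q -> Gam m.
have GSB q q' c : GS q -> GS q' -> GS (q + c *: q').
  by move=> hq hq' m /msuppD_le; rewrite mem_cat => /orP[/hq|/msuppZ_le/hq'].
have th_inj q q' : GS q -> GS q' -> th q = th q' -> q = q'.
  move=> qG q'G qq'; apply/eqP; rewrite -subr_eq0 -scaleN1r; apply/eqP.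
  by apply: th_inj0; [exact: GSB | rewrite linearD linearZ /= qq' scaleN1r subrr].
have [N NP] := choice ex_N.
have NG x : GS (N x) by have [] := NP x.
have NK x : th (N x) = x by have [] := NP x.
have N_lin : linear N.
  move=> c x y; apply: th_inj => //.
    by rewrite addrC; apply: GSB.
  by rewrite linearP !NK.
exists (HB.pack_for {linear R -> {mpoly F[r]}} N (GRing.isLinear.Build _ _ _ _ N N_lin)).
split=> //= [x y xy|q qG]; first by have := congr1 th xy; rewrite !NK.
by apply: th_inj => //; rewrite NK.
Qed.

Section OrderBasis.
Variables (F : fieldType) (r : nat) (lt : rel 'X_{1..r}).
Hypothesis mo : monomial_order lt.
Variables (Gam : 'X_{1..r} -> Prop) (R : comAlgType F).
Variable rho : R -> option 'X_{1..r}.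
Hypothesis hrho : order_function lt Gam rho.
Variable e : 'X_{1..r} -> R.
Hypothesis rho_e : forall m, Gam m -> rho (e m) = Some m.

Lemma rho_combination (th : {linear {mpoly F[r]} -> R}) (q : {mpoly F[r]}) a :
  (forall m, th 'X_[m] = e m) -> (forall m, m \in msupp q -> Gam m) ->
  is_lead_monomial lt q a -> rho (th q) = Some a.
Proof.
move=> thE qG [aq qa].
rewrite [q]mpolyE linear_sum (bigD1_seq a) ?msupp_uniq //= linearZ /= thE.
have rho_a : rho (q@_a *: e a) = Some a.
  by rewrite (rhoZ hrho) -?mcoeff_msupp // rho_e //; apply: qG.
rewrite (rhoDl mo hrho) // rho_a -big_filter.
apply: (rho_sum_lt mo hrho) => m; rewrite mem_filter => /andP[ma mq].
by rewrite linearZ /= thE (rhoZ hrho) -?mcoeff_msupp // rho_e; [exact: qa | exact: qG].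
Qed.

(** Elements of distinct values are independent, since the largest value of a combination survives.
    They span by well-founded descent: subtracting a multiple of [e a] from an element of value a
    lowers its value. So the value of x bounds all exponents in [N x]. *)
Lemma order_coordinates :
  exists N : {linear R -> {mpoly F[r]}},
    [/\ injective N, forall x m, m \in msupp (N x) -> Gam m,
        forall m, Gam m -> N (e m) = 'X_[m] &
        forall x a m, olt lt (rho x) (Some a) -> m \in msupp (N x) -> lt m a].
Proof.
have [th thE] := mpoly_linear_extension e.
pose GS (q : {mpoly F[r]}) := forall m, m \in msupp q -> Gam m.
have GSB q q' c : GS q -> GS q' -> GS (q + c *: q').
  move=> hq hq' m /msuppD_le; rewrite mem_cat => /orP[/hq//|/msuppZ_le/hq'//].
have th_inj0 q : GS q -> th q = 0 -> q = 0.
  move=> qG q0; apply/eqP/negPn/negP => /(lead_monomial_exists mo)[a la].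
  by have := rho_combination thE qG la; rewrite q0 (rho0 hrho).
have th_surj : forall a x, rho x = Some a -> exists q, GS q /\ th q = x.
  elim/(well_founded_ind (mo_wf mo)) => a IH x xa.
  have Ga := of_codom hrho xa.
  have ea0 : e a != 0 by apply/eqP => /(of_0 hrho); rewrite rho_e.
  have [|c c0 hc] := same_lead_exists hrho (x := x) _ ea0; first by rewrite xa rho_e.
  suff [q [qG qE]] : exists q, GS q /\ th q = x - c *: e a.
    exists (q + c *: 'X_[a]); split.
      by apply: GSB => // m; rewrite msuppX inE => /eqP->.
    by rewrite linearD linearZ /= thE qE subrK.
  case E : (rho (x - c *: e a)) => [b|].
    by apply: (IH b) => //; move: hc; rewrite /same_lead rho_e // E.
  by move/(of_0 hrho): E => ->; exists 0; split; rewrite ?linear0 // => m; rewrite msupp0.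
have ex_N x : exists q, GS q /\ th q = x.
  case E : (rho x) => [a|]; first exact: th_surj E.
  by move/(of_0 hrho): E => ->; exists 0; split; rewrite ?linear0 // => m; rewrite msupp0.
have [N [N_inj NG NK N_th]] := coordinates_of_basis th_inj0 ex_N.
exists N; split=> // [m Gm|x a m].
- by rewrite -thE N_th // => k; rewrite msuppX inE => /eqP->.
- move=> xa mx; have [|b lb] := lead_monomial_exists mo (q := N x).
    by rewrite -msupp_eq0; case: (msupp _) mx.
  move: xa; rewrite -[x in rho x]NK (rho_combination thE (NG x) lb) /= => ba.
  by have [->//|mb] := lead_monomial_bound lb mx; apply: (mo_trans mo) mb ba.
Qed.

End OrderBasis.

(** * Flat degeneration of an order domain *)

Section OrderDomainDegeneration.
Variables (F : fieldType) (r s : nat) (lt : rel 'X_{1..r}) (M : 'M[nat]_(r, s)).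
Hypothesis mo : monomial_order lt.
Variables (R : comAlgType F) (rho : R -> option 'X_{1..r}).
Hypothesis hrho : order_function lt (col_semigroup M) rho.
Local Notation wt := (weight M).
Local Notation Gam := (col_semigroup M).

(** Least representatives for a well-founded order compatible with addition, so that replacing a
    divisor [b] of an exponent by [sg (wt b)] terminates. *)
Lemma minimal_section :
  exists sg : 'X_{1..r} -> 'X_{1..s},
    (forall m, Gam m -> wt (sg m) = m) /\ (forall a, sg (wt a) <= a)%O.
Proof.
have ex_sg m : exists a, Gam m -> wt a = m /\ forall b, wt b = m -> (a <= b)%O.
  have [[b ->]|nG] := pselect (Gam m); last by exists 0%MM.
  elim/(well_founded_ind (@ltom_wf s)): b => b IH.
  have [[c [cb wc]]|nc] := pselect (exists c, (c < b)%O /\ wt c = wt b).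
    by rewrite -wc; apply: IH.
  exists b => _; split=> // c wc; rewrite leNgt; apply/negP => cb.
  by apply: nc; exists c.
have [sg sgP] := choice ex_sg.
exists sg; split=> [m /sgP[]//|a].
by have [|_] := sgP (wt a); [exists a | apply].
Qed.

Lemma order_domain_flat_deformation : flat_deformation R (toric_alg F Gam).
Proof.
have [phi [phiX phiB]] := normalised_generators mo hrho.
have [sg [sgE sg_min]] := minimal_section.
pose e m := mmap1 phi (sg m).
have rho_e m : Gam m -> rho (e m) = Some m by move=> Gm; rewrite phiX sgE.
have [N [N_inj N_supp N_e N_lt]] := order_coordinates mo hrho rho_e.
have wtG a : Gam (wt a) by exists a.
(* Every exponent that is not a chosen representative lies above some [b] in [l], so the rules phi^b
   = phi^(sg (wt b)) + d b suffice for rewriting. *)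
have [l [l_ns l_dom]] := dickson (fun a => a <> sg (wt a)).
pose d b := mmap1 phi b - mmap1 phi (sg (wt b)).
(* The finitely many inequalities that [lam] must respect; they hold for [lt] because [d b] has
   value below [wt b]. *)
pose V := [seq (m, wt b) | b <- l, m <- msupp (N (d b))].
have [|lam [lamD lamV]] := monomial_order_weight mo (V := V).
  move=> v /allpairsPdep[b [m [bl mb ->]]] /=; apply: N_lt mb.
  have := phiB b (sg (wt b)); rewrite sgE //; exact.
(* That is, phi^a is [e (wt a)] plus terms of smaller [lam]. The outer induction on the weight
   treats the correction terms, the inner one on the exponent treats the rewritten monomial of the
   same weight. *)
have N_phi a : forall m, (lam (wt a) <= lam m)%N ->
    (N (mmap1 phi a))@_m = (m == wt a)%:R.
  move: {2}(wt a) (erefl (wt a)) => w.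
  elim/(well_founded_ind (mo_wf mo)): w a => w IHw a.
  elim/(well_founded_ind (@ltom_wf s)): a => a IHa aw m am.
  have [a_sg|/l_dom[b bl ba]] := pselect (a = sg (wt a)).
    by rewrite {1}a_sg N_e // mcoeffX eq_sym.
  have aE : a = (a - b + b)%MM by rewrite submK.
  set u := (a - b)%MM in aE.
  have wE : wt a = (wt u + wt b)%MM by rewrite aE weightD.
  have -> : mmap1 phi a = mmap1 phi (u + sg (wt b))%MM + mmap1 phi u * d b.
    by rewrite aE !mmap1D -mulrDr /d addrC subrK.
  rewrite linearD mcoeffD (IHa (u + sg (wt b))%MM); first last.
  - by rewrite weightD sgE // -wE.
  - by rewrite weightD sgE // -wE.
  - rewrite [X in (_ < X)%O]aE ltmc_add2r lt_neqAle sg_min andbT; apply/eqP => e_b.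
    by apply: (l_ns b).
  rewrite weightD sgE // -wE.
  have -> : (N (mmap1 phi u * d b))@_m = 0; last by rewrite addr0.
  rewrite [d b](coord_sum N_inj N_supp N_e) mulr_sumr linear_sum raddf_sum /=.
  rewrite big_seq big1 // => k kb.
  rewrite -scalerAr linearZ /= mcoeffZ -mmap1D.
  have Gk := N_supp _ _ kb.
  (* Both orders drop at [k]: [lam] for the claim, [lt] for the induction. *)
  have lt_kb : (lam k < lam (wt b))%N.
    by apply: (lamV (k, wt b)); apply/allpairsPdep; exists b, k.
  have lt_k : lt (wt (u + sg k)%MM) w.
    rewrite weightD sgE // -aw wE ![(wt u + _)%MM]addmC; apply: (mo_add mo).
    apply: N_lt kb; have := phiB b (sg (wt b)); rewrite sgE //; exact.
  have lam_k : (lam (wt (u + sg k)%MM) < lam m)%N.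
    by apply: leq_trans am; rewrite weightD sgE // wE !lamD ltn_add2l.
  rewrite (IHw _ lt_k _ erefl) ?(ltnW lam_k) //.
  by case: eqVneq lam_k => [->|_]; rewrite ?ltnn // mulr0.
apply: (@coord_flat_deformation F r Gam _ _ R e N lam) => //.
- exact: col_semigroup0.
- exact: col_semigroupD.
(* The order on exponents refines the total degree, so the least exponent of weight 0 is 0. *)
- rewrite /e; suff -> : sg 0%MM = 0%MM by rewrite mmap11.
  apply/eqP; rewrite -mdeg_eq0 -leqn0 -[X in (_ <= X)%N](@mdeg0 s).
  by have := sg_min 0%MM; rewrite weight0 => /lemc_mdeg.
- move=> a b m Ga Gb abm; rewrite /e -mmap1D N_phi ?weightD ?sgE //.
Qed.

End OrderDomainDegeneration.

(** * Groebner bases with two top monomials *)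

Section WeightOrder.
Variables (r s : nat) (lt : rel 'X_{1..r}) (tau : rel 'X_{1..s}).
Variable M : 'M[nat]_(r, s).
Hypotheses (mo : monomial_order lt) (mo_tau : monomial_order tau).
Local Notation wt := (weight M).

Lemma weight_order_monomial_order : monomial_order (weight_order M lt tau).
Proof.
rewrite /weight_order; split=> [a|b a c|a b ab|a b c|a].
- by rewrite (mo_irr mo) (mo_irr mo_tau) andbF.
- case/orP => [ab|/andP[/eqP -> ab]] /orP[bc|/andP[/eqP <- bc]].
  + by rewrite (mo_trans mo ab bc).
  + by rewrite ab.
  + by rewrite bc.
  + by rewrite eqxx (mo_trans mo_tau ab bc) orbT.
- have [wab|wab] := eqVneq (wt a) (wt b).
    by rewrite wab !(mo_irr mo) /=; apply: (mo_total mo_tau).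
  by rewrite !orbF /= ?andbF; have := mo_total mo wab.
- rewrite !weightD => /orP[ab|/andP[/eqP-> ab]].
    by rewrite (mo_add mo).
  by rewrite eqxx (mo_add mo_tau) ?orbT.
- move: {2}(wt a) (erefl (wt a)) => w.
  elim/(well_founded_ind (mo_wf mo)): w a => w IHw a.
  elim/(well_founded_ind (mo_wf mo_tau)): a => a IHa aw.
  constructor=> b /orP[ba|/andP[/eqP ba tba]]; last by apply: IHa; rewrite ?ba.
  by apply: (IHw (wt b)); rewrite -?aw.
Qed.

End WeightOrder.

Section Monomials.
Variables (F : fieldType) (s : nat) (lt : rel 'X_{1..s}).
Implicit Types E : {mpoly F[s]} -> Prop.

(** The coefficient of X^a must be nonzero in some summand, and every monomial of that summand is
    divisible by the leading monomial behind it. *)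
Lemma LT_ideal_monomial E a :
  LT_ideal lt E 'X_[a] ->
  exists f b, [/\ E f, is_lead_monomial lt f b & (b <= a)%MM].
Proof.
case=> n [c [t [tP aE]]].
have : ('X_[a] : {mpoly F[s]})@_a != 0 by rewrite mcoeffX eqxx oner_neq0.
rewrite aE raddf_sum /= => h.
have [i hi] : exists i, (c i * t i)@_a != 0.
  apply: contrapT => nh; move: h; rewrite big1 ?eqxx // => i _; apply/eqP/negPn/negP => hi.
  by apply: nh; exists i.
have [f [b [Ef lb tE]]] := tP i; exists f, b; split=> //.
move: hi; rewrite -mcoeff_msupp => /msuppM_le/allpairsP[[m k] /= [_ kt ->]].
move: kt; rewrite tE => /msuppZ_le; rewrite msuppX inE => /eqP->.
exact: lem_addl.
Qed.

Lemma LT_ideal_lead E f a :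
  E f -> is_lead_monomial lt f a -> LT_ideal lt E 'X_[a].
Proof.
move=> Ef la; have [af _] := la.
have -> : 'X_[a] = (f@_a)^-1%:MP * (f@_a *: 'X_[a]).
  by rewrite mul_mpolyC scalerA mulVf ?scale1r // -mcoeff_msupp.
by apply: ideal_genM; apply: ideal_gen_mem; exists f, a.
Qed.

End Monomials.

Section GroebnerOrderDomain.
Variables (F : fieldType) (r s : nat) (lt : rel 'X_{1..r}) (tau : rel 'X_{1..s}).
Variable M : 'M[nat]_(r, s).
Hypotheses (mo : monomial_order lt) (mo_tau : monomial_order tau).
Variables (I : {pred {mpoly F[s]}}) (G : seq {mpoly F[s]}).
Hypothesis I_ideal : is_ideal I.
Local Notation wt := (weight M).
Local Notation Gam := (col_semigroup M).
Local Notation wo := (weight_order M lt tau).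
Hypothesis GB : reduced_groebner_basis wo I G.
Hypothesis G_top : forall g, g \in G -> size (top_weight_monomials M lt g) = 2%N.
Let std a := ~ LT_ideal wo (fun f => f \in I) 'X_[a].
Hypothesis std_inj : forall a b, std a -> std b -> wt a = wt b -> a = b.

Let mo_wo : monomial_order wo := weight_order_monomial_order M mo mo_tau.

(** Since [wo] compares weights first, the leading monomial is one of the two of top weight; [b] is
    the other. *)
Lemma groebner_binomial_head g a : g \in G -> is_lead_monomial wo g a ->
  exists b, [/\ b \in msupp g, b != a, wt b = wt a &
    forall m, m \in msupp g -> m != a -> m != b -> lt (wt m) (wt a)].
Proof.
move=> gG [ag ha].
have le_a m : m \in msupp g -> wt m = wt a \/ lt (wt m) (wt a).
  move=> mg; have [->|/(ha _ mg)] := eqVneq m a; first by left.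
  by case/orP => [|/andP[/eqP]]; [right|left].
have [T TE] : exists T, T = top_weight_monomials M lt g by eexists.
have TP m : (m \in T) = (m \in msupp g) && (wt m == wt a).
  rewrite TE mem_filter andbC; case: (boolP (m \in msupp g)) => //= mg.
  apply/allP/eqP => [/(_ a ag) h|wm k kg].
    by have [//|h'] := le_a m mg; rewrite h' in h.
  rewrite wm; apply/negP => ak; have [kE|ka] := le_a k kg.
    by rewrite kE (mo_irr mo) in ak.
  by have := mo_trans mo ak ka; rewrite (mo_irr mo).
have aT : a \in T by rewrite TP ag eqxx.
have T_uniq : uniq T by rewrite TE filter_uniq ?msupp_uniq.
have [b [bT ba ab]] : exists b, [/\ b \in T, b != a & forall m, m \in T -> m != a -> m = b].
  move: (G_top gG) aT T_uniq; rewrite -TE {TE TP}.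
  case: T => [|x [|y []]] //= _; rewrite !inE.
  case/orP => /eqP-> /andP[xy _].
    exists y; split=> [||m]; rewrite ?inE ?eqxx ?orbT 1?eq_sym //.
    by case/orP => /eqP-> //; rewrite eqxx.
  exists x; split=> [||m]; rewrite ?inE ?eqxx //.
  by case/orP => /eqP-> //; rewrite eqxx.
move: (bT); rewrite TP => /andP[bg /eqP wb]; exists b; split=> // m mg ma mb.
have [wm|//] := le_a m mg; case/eqP: mb; apply: ab => //.
by rewrite TP mg wm eqxx.
Qed.

(** Otherwise some basis element has leading monomial 1, and its second top monomial would lie below
    the exponent 0. *)
Lemma groebner_nonunit : 1 \notin I.
Proof.
apply/negP => I1.
have : LT_ideal wo (fun f => f \in I) 'X_[0].
  apply: (LT_ideal_lead (f := 1)) => //.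
  by split=> [|b]; rewrite msupp1 inE // => ->.
move=> /(rgb_lead GB)/LT_ideal_monomial[g [a [gG la a0]]].
have {}a0 : a = 0%MM.
  by apply/mnmP => i; have /mnm_lepP/(_ i) := a0; rewrite mnm0E leqn0 => /eqP.
have [b [bg ba _ _]] := groebner_binomial_head gG la.
have := la.2 b bg ba; rewrite a0 => h; have := monomial_order_gt0 mo_wo (a := b).
rewrite -a0 ba a0 => /(_ isT) h'; have := mo_trans mo_wo h h'.
by rewrite (mo_irr mo_wo).
Qed.

(** If X^a is X^u times the leading monomial of a basis element [g], subtract X^u g: the second top
    term of [g] yields c X^b and the remaining terms yield [q]. *)
Lemma groebner_reduction a : ~ std a ->
  exists b c q, [/\ c != 0, wo b a, wt b = wt a,
    forall m, m \in msupp q -> lt (wt m) (wt a) &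
    'X_[a] - (c *: 'X_[b] + q) \in I].
Proof.
move=> /contrapT/(rgb_lead GB)/LT_ideal_monomial[g [a0 [gG la a0a]]].
have ga0 : g@_a0 = 1.
  have [a1 [la1 ga1]] := rgb_monic GB gG.
  by rewrite (lead_monomial_unique mo_wo la la1).
have [b [bg ba wb g_lt]] := groebner_binomial_head gG la.
have aE : a = (a - a0 + a0)%MM by rewrite submK.
set u := (a - a0)%MM in aE.
pose q0 := g - 'X_[a0] - g@_b *: 'X_[b].
have q0E m : q0@_m = if (m == a0) || (m == b) then 0 else g@_m.
  rewrite !mcoeffB mcoeffZ !mcoeffX ![_ == m]eq_sym.
  have [->|ma] := eqVneq m a0; first by rewrite eq_sym (negbTE ba) ga0 mulr0 subrr subr0.
  by have [->|mb] := eqVneq m b; rewrite ?mulr1 ?subr0 ?subrr ?mulr0 ?subr0.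
exists (u + b)%MM, (- g@_b), (- ('X_[u] * q0)); split.
- by rewrite oppr_eq0 -mcoeff_msupp.
- rewrite aE ![(u + _)%MM]addmC; apply: (mo_add mo_wo); exact: la.2.
- by rewrite aE !weightD wb.
- move=> m; rewrite (perm_mem (msuppN _)) => /msuppM_le/allpairsP[[k l] /= [ku lq ->]].
  move: ku; rewrite msuppX inE => /eqP->; rewrite aE !weightD ![(wt u + _)%MM]addmC.
  apply: (mo_add mo); move: lq; rewrite mcoeff_msupp q0E.
  case: ifPn; rewrite ?eqxx // negb_or -mcoeff_msupp => /andP[la0 lb] lg.
  exact: g_lt.
have -> : 'X_[a] - (- g@_b *: 'X_[u + b] + - ('X_[u] * q0)) = 'X_[u] * g.
  rewrite aE !mpolyXD /q0 !mulrBr -scalerAr scaleNr; ring.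
by have := I_ideal.2 'X_[u] g 0; rewrite addr0; apply; [exact: (rgb_sub GB)|exact: I_ideal.1].
Qed.

(** Reduction keeps the weight and descends for [wo], so it ends at a standard monomial of the given
    weight. *)
Lemma standard_section :
  exists sg : 'X_{1..r} -> 'X_{1..s}, forall m, Gam m -> std (sg m) /\ wt (sg m) = m.
Proof.
have ex_sg m : exists a, Gam m -> std a /\ wt a = m.
  have [[b ->]|nG] := pselect (Gam m); last by exists 0%MM.
  elim/(well_founded_ind (mo_wf mo_wo)): b => b IH.
  have [sb|/groebner_reduction[c [_ [_ [_ cb wc _ _]]]]] := pselect (std b).
    by exists b.
  by rewrite -wc; apply: IH.
have [sg sgP] := choice ex_sg; by exists sg.
Qed.

Lemma groebner_order_domain :
  exists J : idealr {mpoly F[s]}, (forall f, f \in J <-> f \in I) /\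
    exists rho : quot_alg J -> option 'X_{1..r}, order_function lt Gam rho.
Proof.
have [J JE] := is_ideal_idealr I_ideal groebner_nonunit.
exists J; split=> [f|]; first by rewrite JE.
have [sg sgP] := standard_section.
pose R : comAlgType F := quot_alg J.
pose pi : {mpoly F[s]} -> R := \pi_(quot_alg J).
have piP p q : pi p = pi q <-> p - q \in I by rewrite quot_alg_pi_eq JE.
have piL c p q : pi (c *: p + q) = c *: pi p + pi q.
  by rewrite /pi rmorphD quot_alg_piZ.
have [th thX] := mpoly_linear_extension (fun m => pi 'X_[sg m]).
pose GS (q : {mpoly F[r]}) := forall m, m \in msupp q -> Gam m.
have GSB q q' c : GS q -> GS q' -> GS (c *: q + q').
  by move=> hq hq' m /msuppD_le; rewrite mem_cat => /orP[/msuppZ_le/hq|/hq'].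
have GS0 : GS 0 by move=> m; rewrite msupp0.
have wtG a : Gam (wt a) by exists a.
have GSX a : GS 'X_[wt a] by move=> m; rewrite msuppX inE => /eqP->.
have pi_sum (P : {mpoly F[r]} -> Prop) q :
    P 0 -> (forall c p p', P p -> P p' -> P (c *: p + p')) ->
    (forall m, m \in msupp q -> exists p, P p /\ pi 'X_[m] = th p) ->
    exists p, P p /\ pi q = th p.
  move=> P0 PL; rewrite [q in pi q]mpolyE; elim: (msupp q) => [|m l IH] h.
    by exists 0; rewrite big_nil linear0 /pi rmorph0.
  have [m' m'l|p [Pp pE]] := IH; first by apply: h; rewrite inE m'l orbT.
  have [p' [Pp' pE']] := h m (mem_head _ _).
  exists (q@_m *: p' + p); split; first exact: PL.
  by rewrite big_cons piL pE pE' linearP.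
(* Normal forms keep the leading weight: reduction gives a nonzero multiple of a smaller monomial of
   the same weight, plus lower weights that cannot cancel it. *)
have normal a : exists q, [/\ GS q, is_lead_monomial lt q (wt a) & pi 'X_[a] = th q].
  elim/(well_founded_ind (mo_wf mo_wo)): a => a IH.
  have [sa|] := pselect (std a).
    exists 'X_[wt a]; split=> //.
      by split=> [|b]; rewrite msuppX inE // => ->.
    (* Standard monomials have distinct weights, so [a] is the chosen representative of its
       weight. *)
    have [ssg wsg] := sgP _ (wtG a).
    by rewrite thX (std_inj ssg sa wsg).
  move=> /groebner_reduction[b [c [q [c0 ba wb q_lt XI]]]].
  have [qb [Gqb lqb qbE]] := IH b ba.
  pose P p := GS p /\ forall k, k \in msupp p -> lt k (wt a).
  have [||m mq|p [[Gp p_lt] pE]] := pi_sum P q.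
  - by split=> // k; rewrite msupp0.
  - move=> d p p' [Gp hp] [Gp' hp']; split; first exact: GSB.
    by move=> k /msuppD_le; rewrite mem_cat => /orP[/msuppZ_le/hp|/hp'].
  - have wm := q_lt m mq; have [|qm [Gqm lqm qmE]] := IH m.
      by rewrite /weight_order wm.
    exists qm; split=> //; split=> // k /(lead_monomial_bound lqm)[->//|km].
    exact: (mo_trans mo) km wm.
  exists (c *: qb + p); split; first exact: GSB.
    have pa : p@_(wt a) = 0.
      by apply/eqP; rewrite mcoeff_eq0; apply/negP => /p_lt; rewrite (mo_irr mo).
    rewrite -wb; have [aq hq] := lqb; split=> [|k].
      by rewrite mcoeff_msupp mcoeffD mcoeffZ wb pa addr0 mulf_neq0 // -wb -mcoeff_msupp.
    by move=> /msuppD_le; rewrite mem_cat => /orP[/msuppZ_le/hq//|/p_lt]; rewrite wb.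
  by rewrite linearP /= -qbE -pE -piL; apply/piP.
(* A relation would give a nonzero element of [I] whose leading monomial is standard. The polynomial
   [q] is recovered from [p] by [weight_map], because [sg m] has weight m. *)
have th_inj0 q : GS q -> th q = 0 -> q = 0.
  move=> qG thq; pose p : {mpoly F[s]} := \sum_(m <- msupp q) q@_m *: 'X_[sg m].
  have pE : pi p = th q.
    rewrite /p [q in th q]mpolyE linear_sum /pi raddf_sum; apply: eq_bigr => m _.
    by rewrite linearZ /= thX -quot_alg_piZ.
  have pI : p \in I.
    by rewrite -[p]subr0; apply/piP; rewrite pE thq /pi rmorph0.
  have wp : weight_map M p = q.
    have wmL := linear_for_sumZ (weight_map_linear (F := F) M).
    rewrite /p wmL [RHS]mpolyE big_seq [RHS]big_seq; apply: eq_bigr => m /qG Gm.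
    by rewrite weight_mapX (sgP _ Gm).2.
  have supp_p b : b \in msupp p -> exists2 m, Gam m & b = sg m.
    move=> /msupp_sum_le/flatten_mapP[m]; rewrite filter_predT => /qG Gm.
    by move=> /msuppZ_le; rewrite msuppX inE => /eqP->; exists m.
  clearbody p; have [p0|/(lead_monomial_exists mo_wo)[b lb]] := eqVneq p 0.
    by rewrite -wp p0 /weight_map mmap0.
  have [/supp_p[m Gm bE] _] := lb; have [sb _] := sgP _ Gm.
  case: sb; rewrite -bE; exact: LT_ideal_lead lb.
have th_surj x : exists q, GS q /\ th q = x.
  have [|m _|p [Gp pE]] := pi_sum GS (repr x) GS0.
  - by move=> c p p'; apply: GSB.
  - by have [q [Gq _ qE]] := normal m; exists q.
  - by exists p; split=> //; rewrite -pE /pi reprK.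
have [N [N_inj NG NK N_th]] := coordinates_of_basis th_inj0 th_surj.
apply: (coord_order_function mo (e := fun m => pi 'X_[sg m]) N_inj NG) => [m Gm|a b Ga Gb].
  by rewrite -thX N_th // => k; rewrite msuppX inE => /eqP->.
(* The product of two basis elements is the class of X^(sg a + sg b), whose normal form leads with a
   + b. *)
have [q [Gq lq qE]] := normal (sg a + sg b)%MM.
have -> : pi 'X_[sg a] * pi 'X_[sg b] = th q by rewrite -qE mpolyXD /pi rmorphM.
rewrite N_th //.
by move: lq; rewrite weightD (sgP _ Ga).2 (sgP _ Gb).2.
Qed.

End GroebnerOrderDomain.

Theorem theorem4 (F : finFieldType) (r : nat) (lt : rel 'X_{1..r})
    (hlt : monomial_order lt) :
  (forall (s : nat) (M : 'M[nat]_(r, s)) (R : comAlgType F)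
      (rho : R -> option 'X_{1..r}),
    order_function lt (col_semigroup M) rho ->
    (exists J : idealr {mpoly F[s]},
       (forall f, f \in J <-> toric_ideal M f) /\
       alg_iso (quot_alg J) (toric_alg F (col_semigroup M))) /\
    flat_deformation R (toric_alg F (col_semigroup M)))
  /\
  (forall (s : nat) (M : 'M[nat]_(r, s)) (tau : rel 'X_{1..s})
      (I : {pred {mpoly F[s]}}) (G : seq {mpoly F[s]}),
    rows_independent M ->
    monomial_order tau ->
    is_ideal I ->
    reduced_groebner_basis (weight_order M lt tau) I G ->
    (forall g, g \in G -> size (top_weight_monomials M lt g) = 2%N) ->
    (forall a b : 'X_{1..s},
       ~ LT_ideal (weight_order M lt tau) (fun f => f \in I) 'X_[a] ->
       ~ LT_ideal (weight_order M lt tau) (fun f => f \in I) 'X_[b] ->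
       weight M a = weight M b -> a = b) ->
    exists J : idealr {mpoly F[s]},
      [/\ (forall f, f \in J <-> f \in I),
          flat_deformation (quot_alg J) (toric_alg F (col_semigroup M)) &
          exists rho : quot_alg J -> option 'X_{1..r},
            order_function lt (col_semigroup M) rho]).
Proof.
split=> [s M R rho hrho|s M tau I G _ mo_tau I_ideal GB G_top std_inj].
  by split; [exact: toric_quotient | exact: order_domain_flat_deformation hrho].
have [J [JI [rho hrho]]] := groebner_order_domain hlt mo_tau I_ideal GB G_top std_inj.
exists J; split=> //; last by exists rho.
(* The order function just constructed makes part (a) applicable to the quotient. *)
exact: order_domain_flat_deformation hrho.
Qed.
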